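(* For any non-constant polynomial $P$ (with coefficients in $\mathbb{K}$), the operator $P(D)$, where $D$ is the derivative operator $f\mapsto f'$, possesses a hypercyclic subspace of type $1$ in $C^{\infty}(\mathbb{R})$.
   Context: $\mathbb{K}=\mathbb{R}$ or $\mathbb{C}$. $C^{\infty}(\mathbb{R})$ is the Fréchet space of infinitely differentiable ($\mathbb{K}$-valued) functions on $\mathbb{R}$, endowed with the increasing sequence of seminorms $p_k(f)=\sum_{l=0}^{k-1}\sup_{x\in[-k,k]}|f^{(l)}(x)|$, $k\ge 1$. For a continuous linear operator $T:X\to X$ on a Fréchet space $X$, a vector $x$ is hypercyclic if its orbit $\{T^n x\}_n$ is dense in $X$; a hypercyclic subspace is a closed infinite-dimensional subspace $M$ of $X$ in which every non-zero vector is hypercyclic for $T$. A hypercyclic subspace $M$ is of type $1$ if there exists a continuous seminorm $p$ on $X$ such that $M\cap\ker p=\{0\}$. *)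

(* Defs.v *)
From HB Require Import structures.
From mathcomp Require Import all_boot all_order all_algebra.
From mathcomp Require Import all_classical all_reals all_analysis.
From mathcomp Require Import complex.

Set Implicit Arguments.
Unset Strict Implicit.
Unset Printing Implicit Defensive.

Import Order.TTheory GRing.Theory Num.Theory.
Import numFieldNormedType.Exports.

Local Open Scope classical_set_scope.
Local Open Scope ring_scope.

(* Common interface to the two fields of scalars R and C.  The norm of a
   [numFieldType] takes its values in the field itself; [absr] is the same
   absolute value, seen as a real number. *)
Record scalars (R : realType) := Scalars {
  scalar :> numFieldType;
  of_real : {rmorphism R -> scalar};
  absr : scalar -> R;
  of_real_mono : {mono of_real : x y / x <= y};
  of_real_absr : forall z, of_real (absr z) = `|z|
}.

Lemma real_of_real_mono (R : realType) :
  {mono (idfun : {rmorphism R -> R}) : x y / x <= y}.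
Proof. by []. Qed.

Lemma real_of_real_absr (R : realType) (z : R) :
  (idfun : {rmorphism R -> R}) (Num.norm z) = `|z|.
Proof. by []. Qed.

Definition real_scalars (R : realType) : scalars R :=
  Scalars (@real_of_real_mono R) (@real_of_real_absr R).

Lemma complex_of_real_mono (R : realType) :
  {mono (real_complex R : {rmorphism R -> R[i]}) : x y / x <= y}.
Proof. by move=> x y; exact: lecR. Qed.

Lemma complex_of_real_absr (R : realType) (z : R[i]) :
  (real_complex R : {rmorphism R -> R[i]}) (Normc.normc z) = `|z|.
Proof. by []. Qed.

Definition complex_scalars (R : realType) : scalars R :=
  Scalars (@complex_of_real_mono R) (@complex_of_real_absr R).

Section hypercyclicity.
Context {R : realType} {K : scalars R}.

Definition seminorm (X : lmodType K) (p : X -> R) :=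
  (forall x y, p (x + y) <= p x + p y) /\
  (forall (c : K) x, p (c *: x) = absr c * p x).

Definition subspace (X : lmodType K) (M : set X) :=
  M 0 /\ forall (c : K) x y, M x -> M y -> M (c *: x + y).

Definition finite_dimensional (X : lmodType K) (M : set X) :=
  exists n (e : 'I_n -> X), (forall i, M (e i)) /\
    forall x, M x -> exists c : 'I_n -> K, x = \sum_(i < n) c i *: e i.

Definition hypercyclic (X : tvsType K) (T : {linear X -> X}) (x : X) :=
  dense (range (fun n => iter n T x)).

Definition hypercyclic_subspace (X : tvsType K) (T : {linear X -> X})
    (M : set X) :=
  [/\ subspace M, closed M, ~ finite_dimensional M &
      forall x, M x -> x != 0 -> hypercyclic T x].

Definition of_type1 (X : tvsType K) (M : set X) :=
  exists p : X -> R, [/\ seminorm p, continuous p &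
    M `&` [set x | p x = 0] = [set 0]].

Definition has_hypercyclic_subspace_of_type1 (X : tvsType K)
    (T : {linear X -> X}) :=
  exists M : set X, hypercyclic_subspace T M /\ of_type1 M.

End hypercyclicity.

(* K seen as a real normed space, so that the library's derivatives apply to
   K-valued functions of a real variable. *)
Definition realified (R : realType) (K : scalars R) : Type := K.

HB.instance Definition _ (R : realType) (K : scalars R) :=
  GRing.Zmodule.on (realified K).

Section realified.
Context {R : realType} {K : scalars R}.
Implicit Types (r : R) (z : realified K).

Let scale r z : realified K := of_real K r * (z : K).

Let scaleA r s z : scale r (scale s z) = scale (r * s) z.
Proof. by rewrite /scale rmorphM mulrA. Qed.
Let scale1 : left_id 1 scale.
Proof. by move=> z; rewrite /scale rmorph1 mul1r. Qed.
Let scaleDr : right_distributive scale +%R.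
Proof. by move=> r x y; rewrite /scale mulrDr. Qed.
Let scaleDl z : {morph scale^~ z : r s / r + s}.
Proof. by move=> r s; rewrite /scale rmorphD mulrDl. Qed.

HB.instance Definition _ := @GRing.Zmodule_isLmodule.Build R (realified K)
  scale scaleA scale1 scaleDr scaleDl.

Lemma absrD (x y : K) : absr (x + y) <= absr x + absr y.
Proof. by rewrite -(of_real_mono K) rmorphD !of_real_absr ler_normD. Qed.

Lemma absrM (x y : K) : absr (x * y) = absr x * absr y.
Proof.
by apply: (fmorph_inj (of_real K)); rewrite rmorphM !of_real_absr normrM.
Qed.

Lemma absr_ge0 (x : K) : 0 <= absr x.
Proof. by rewrite -(of_real_mono K) rmorph0 of_real_absr. Qed.

Lemma absr_of_real (r : R) : absr (of_real K r) = `|r|.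
Proof.
apply: (fmorph_inj (of_real K)); rewrite of_real_absr.
have [r0|/ltW r0] := leP 0 r.
  by rewrite (ger0_norm r0) ger0_norm // -(rmorph0 (of_real K)) of_real_mono.
rewrite (ler0_norm r0) rmorphN ler0_norm //.
by rewrite -(rmorph0 (of_real K)) of_real_mono.
Qed.

Lemma absr0_eq0 (x : K) : absr x = 0 -> x = 0.
Proof.
by move=> x0; apply/normr0_eq0; rewrite -of_real_absr x0 rmorph0.
Qed.

Let absrZ r z : absr (r *: z : realified K) = `|r| * absr z.
Proof. by rewrite absrM absr_of_real. Qed.

HB.instance Definition _ := @Lmodule_isNormed.Build R (realified K)
  (@absr R K : realified K -> R) absrD absrZ absr0_eq0.

End realified.

Lemma seminorm_ball_convex {R : realType} {K : scalars R} (X : lmodType K)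
    (p : X -> R) (f u v : X) (e : R) (a : K) :
  seminorm p -> 0 <= a -> a <= 1 ->
  p (u - f) < e -> p (v - f) < e -> p (a *: u + (1 - a) *: v - f) < e.
Proof.
move=> [pD pZ] a0 a1 uf vf.
have aE : absr a + absr (1 - a) = 1.
  apply: (fmorph_inj (of_real K)); rewrite rmorphD rmorph1 !of_real_absr.
  by rewrite !ger0_norm ?subr_ge0 // addrCA subrr addr0.
have -> : a *: u + (1 - a) *: v - f = a *: (u - f) + (1 - a) *: (v - f).
  by rewrite !scalerBr addrACA -opprD -scalerDl addrCA subrr addr0 scale1r.
have Me : Num.max (p (u - f)) (p (v - f)) < e by rewrite gt_max uf vf.
apply: le_lt_trans Me; rewrite (le_trans (pD _ _)) // !pZ.
rewrite -[leRHS]mul1r -aE mulrDl lerD // ler_wpM2l ?absr_ge0 //.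
  by rewrite le_max lexx.
by rewrite le_max lexx orbT.
Qed.

Section smooth_functions.
Context {R : realType} (K : scalars R).

Definition smooth : {pred R -> K^o} :=
  fun f => `[< forall n x, derivable (derive1n n (f : R -> realified K)) x 1 >].

Record Cinf := MkCinf { cinf_fun :> R -> K^o ; _ : smooth cinf_fun }.

Lemma smoothP (f : R -> K) : reflect
  (forall n x, derivable (derive1n n (f : R -> realified K)) x 1) (smooth f).
Proof. exact: asboolP. Qed.

Lemma mull_continuous (c : K) :
  continuous (fun z : realified K => (c : K) * z : realified K).
Proof.
have c1 : 0 < absr c + 1 by rewrite ltr_wpDl // absr_ge0.
move=> z; apply/(@cvgrPdist_lt _ _ _ (nbhs z)) => e e0; near=> y.
rewrite -mulrBr [ltLHS](absrM c (z - y)).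
rewrite (@le_lt_trans _ _ ((absr c + 1) * `|z - y|)) //.
  by apply: ler_wpM2r; [exact: absr_ge0|rewrite lerDl].
rewrite mulrC -ltr_pdivlMr //; near: y; apply: cvgr_dist_lt => //.
exact: divr_gt0.
Unshelve. all: by end_near. Qed.

Lemma derivable_mull (c : K) (f : R -> realified K) x : derivable f x 1 ->
  derivable (fun y => (c : K) * f y : realified K) x 1 /\
  derive1 (fun y => (c : K) * f y : realified K) x = (c : K) * derive1 f x.
Proof.
move=> df.
have H : (fun h : R => h^-1 *: (((fun y => (c : K) * f y : realified K) \o shift x)
    (h *: 1) - (c : K) * f x : realified K)) @ 0^' --> ((c : K) * derive1 f x : realified K).
  rewrite (_ : (fun h => _) = (fun z : realified K => (c : K) * z : realified K) \o
    (fun h : R => h^-1 *: ((f \o shift x) (h *: 1) - f x))); last first.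
    apply/funext => h /=; rewrite -mulrBr; exact: mulrCA.
  apply: continuous_cvg; first exact: mull_continuous.
  by rewrite derive1E; exact: df.
split; first by apply/cvg_ex; exists ((c : K) * derive1 f x).
by rewrite derive1E; exact: cvg_lim.
Qed.

Lemma smooth_lin (c : K) (f g : R -> realified K) :
  (forall n x, derivable (derive1n n f) x 1) -> (forall n x, derivable (derive1n n g) x 1) ->
  forall n, derive1n n (fun x => (c : K) * f x + g x : realified K) =
     (fun x => (c : K) * derive1n n f x + derive1n n g x).
Proof.
move=> sf sg; elim=> [//|n IHn]; rewrite derive1nS IHn.
apply/funext => x; have [d1 d2] := derivable_mull c (sf n x).
rewrite derive1E.
rewrite (_ : (fun _ => _) = (fun y => (c : K) * (derive1n n f y) : realified K) + derive1n n g) //.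
by rewrite deriveD // -!derive1E d2.
Qed.

Lemma smooth_closed : submod_closed smooth.
Proof.
split=> [|c f g /smoothP sf /smoothP sg]; apply/smoothP => n x.
  suff -> : derive1n n (0 : R -> realified K) = 0 by exact: derivable_cst.
  elim: n => [//|n IHn]; rewrite derive1nS IHn; apply/funext => y.
  by rewrite derive1E derive_cst.
rewrite (_ : derive1n n (c *: f + g : R -> realified K) =
  (fun x => (c : K) * derive1n n (f : R -> realified K) x + derive1n n (g : R -> realified K) x)).
  exact: derivableD (derivable_mull c (sf n x)).1 (sg n x).
exact: smooth_lin.
Qed.

HB.instance Definition _ := GRing.isSubmodClosed.Build K (R -> K^o) smooth
  smooth_closed.

HB.instance Definition _ := [isSub for cinf_fun].
HB.instance Definition _ := [Choice of Cinf by <:].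
HB.instance Definition _ := [SubChoice_isSubLmodule of Cinf by <:].

Definition derivn (n : nat) (f : Cinf) : R -> realified K :=
  derive1n n (f : R -> realified K).

Definition pk (k : nat) (f : Cinf) : R :=
  \sum_(l < k) sup [set `|derivn l f x| | x in `[- k%:R, k%:R]].

Lemma derivable_derivn n (f : Cinf) x : derivable (derivn n f) x 1.
Proof. by case: f => f sf; move/smoothP : (sf); exact. Qed.

Lemma derivn_lin n (c : K) (f g : Cinf) x :
  derivn n (c *: f + g) x = (c : K) * derivn n f x + derivn n g x.
Proof.
rewrite /derivn; have /= -> // := smooth_lin c (f := f) (g := g).
- by move=> m y; exact: derivable_derivn.
- by move=> m y; exact: derivable_derivn.
Qed.

Lemma derivn0 n x : derivn n (0 : Cinf) x = 0.
Proof.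
have := derivn_lin n 1 0 0 x; rewrite scale1r addr0 mul1r.
by move/(congr1 (fun z : K => z - (derivn n 0 x : K))); rewrite addrK subrr.
Qed.

Lemma derivnZ n (c : K) (f : Cinf) x :
  derivn n (c *: f) x = (c : K) * derivn n f x.
Proof. by rewrite -[c *: f]addr0 derivn_lin derivn0 addr0. Qed.

Lemma derivnD n (f g : Cinf) x :
  derivn n (f + g) x = derivn n f x + derivn n g x.
Proof. by rewrite -[f in LHS]scale1r derivn_lin mul1r. Qed.

Lemma has_sup_derivn n (f : Cinf) (k : nat) :
  has_sup [set `|derivn n f x| | x in `[- k%:R, k%:R]].
Proof.
have k0 : - k%:R <= k%:R :> R by rewrite ge0_cp.
have cf : {within `[- k%:R, k%:R], continuous (fun x => `|derivn n f x|)}.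
  apply: continuous_subspaceT => x; apply: continuous_comp.
    by apply/differentiable_continuous/derivable1_diffP/derivable_derivn.
  exact: norm_continuous.
split; first by exists `|derivn n f 0|, 0 => //=; rewrite in_itv /= oppr_le0 !ler0n.
have [c _ fc] := EVT_max k0 cf.
by exists `|derivn n f c| => _ [x xk <-]; exact: fc.
Qed.

Lemma sup_derivn_ub n (f : Cinf) (k : nat) x : x \in `[- k%:R, k%:R] ->
  `|derivn n f x| <= sup [set `|derivn n f x| | x in `[- k%:R, k%:R]].
Proof. by move=> xk; apply: sup_ubound; [exact: (has_sup_derivn _ _ _).2|exists x]. Qed.

Lemma sup_derivn_le n (f : Cinf) (k : nat) (M : R) :
  (forall x, x \in `[- k%:R, k%:R] -> `|derivn n f x| <= M) ->
  sup [set `|derivn n f x| | x in `[- k%:R, k%:R]] <= M.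
Proof.
by move=> fM; apply: ge_sup; [exact: (has_sup_derivn _ _ _).1|move=> _ [x /fM ? <-]].
Qed.

Lemma sup_derivn_ge0 n (f : Cinf) (k : nat) :
  0 <= sup [set `|derivn n f x| | x in `[- k%:R, k%:R]].
Proof.
rewrite (le_trans (normr_ge0 (derivn n f 0))) // sup_derivn_ub //.
by rewrite in_itv /= oppr_le0 !ler0n.
Qed.

Lemma pkD k (f g : Cinf) : pk k (f + g) <= pk k f + pk k g.
Proof.
rewrite -big_split ler_sum // => l _; apply: sup_derivn_le => x xk.
by rewrite derivnD (le_trans (ler_normD _ _)) // lerD // sup_derivn_ub.
Qed.

Lemma pkZ_le k (c : K) (f : Cinf) : pk k (c *: f) <= absr c * pk k f.
Proof.
rewrite mulr_sumr ler_sum // => l _; apply: sup_derivn_le => x xk.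
rewrite derivnZ [leLHS]absrM; apply: ler_wpM2l; first exact: absr_ge0.
exact: sup_derivn_ub.
Qed.

Lemma pkZ k (c : K) (f : Cinf) : pk k (c *: f) = absr c * pk k f.
Proof.
have a0 : absr (0 : K) = 0 :> R := normr0 (realified K).
apply/le_anti; rewrite pkZ_le /=.
have [->|c0] := eqVneq c 0.
  by rewrite a0 mul0r; apply: sumr_ge0 => l _; exact: sup_derivn_ge0.
rewrite -[in leLHS](scalerK c0 f) (le_trans (ler_wpM2l _ (pkZ_le _ _ _))) //.
  exact: absr_ge0.
by rewrite mulrA -absrM mulfV // -(rmorph1 (of_real K)) absr_of_real normr1 mul1r.
Qed.

Lemma pk_seminorm k : seminorm (pk k).
Proof. by split; [exact: pkD|exact: pkZ]. Qed.

Lemma pk_ge0 k (f : Cinf) : 0 <= pk k f.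
Proof. by apply: sumr_ge0 => l _; exact: sup_derivn_ge0. Qed.

Lemma pk0 k : pk k 0 = 0.
Proof.
have a0 : absr (0 : K) = 0 :> R := normr0 (realified K).
by rewrite -(scale0r 0) pkZ a0 mul0r.
Qed.

Lemma pkN k (f : Cinf) : pk k (- f) = pk k f.
Proof.
rewrite -scaleN1r pkZ -(rmorph1 (of_real K)) -rmorphN absr_of_real.
by rewrite normrN1 mul1r.
Qed.

Lemma pk_mono k m (f : Cinf) : (k <= m)%N -> pk k f <= pk m f.
Proof.
move=> km; rewrite /pk -(subnKC km) big_split_ord /= ler_wpDr //.
  by apply: sumr_ge0 => l _; exact: sup_derivn_ge0.
apply: ler_sum => l _; apply: sup_derivn_le => x.
rewrite in_itv /= => /andP[x1 x2]; apply: sup_derivn_ub; rewrite in_itv /=.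
have km' : k%:R <= (k + (m - k))%:R :> R by rewrite ler_nat leq_addr.
by rewrite (le_trans x2 km') (le_trans _ x1) // lerN2.
Qed.

(* The sequence [pk] is increasing, so the balls of the single seminorms form
   a base of neighborhoods (with [pk 0 = 0]). *)
Definition pk_nbhs (f : Cinf) : set_system Cinf :=
  [set A | exists k (e : R), 0 < e /\ [set g | pk k (g - f) < e] `<=` A].

HB.instance Definition _ := hasNbhs.Build Cinf pk_nbhs.

Let pk_nbhs_filter (f : Cinf) : ProperFilter (nbhs f).
Proof.
apply: Build_ProperFilter_ex.
  by move=> A [k [e [e0 /(_ f)]]] /= Af; exists f; apply: Af; rewrite subrr pk0.
split=> [|A B [k [e [e0 kA]]] [m [d [d0 mB]]]|A B AB [k [e [e0 kA]]]].
- by exists 0, 1.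
- exists (maxn k m), (Num.min e d); split; first by rewrite lt_min e0.
  move=> g /=; rewrite lt_min => /andP[ge gd]; split; [apply: kA|apply: mB] => /=.
    by apply: le_lt_trans ge; rewrite pk_mono // leq_maxl.
  by apply: le_lt_trans gd; rewrite pk_mono // leq_maxr.
- by exists k, e; split=> //; exact: subset_trans AB.
Qed.

Let pk_nbhs_singleton (f : Cinf) (A : set Cinf) : nbhs f A -> A f.
Proof. by move=> [k [e [e0]]]; apply; rewrite /= subrr pk0. Qed.

Let pk_nbhs_nbhs (f : Cinf) (A : set Cinf) : nbhs f A -> nbhs f (nbhs^~ A).
Proof.
move=> [k [e [e0 kA]]]; exists k, e; split=> // g /= ge.
exists k, (e - pk k (g - f)); split; first by rewrite subr_gt0.
move=> h /= he; apply: kA => /=; rewrite -(subrKA g) (le_lt_trans (pkD _ _ _)) //.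
by rewrite -ltrBrDr.
Qed.

HB.instance Definition _ := Nbhs_isNbhsTopological.Build Cinf
  pk_nbhs_filter pk_nbhs_singleton pk_nbhs_nbhs.

Lemma nbhs_pk (f : Cinf) k (e : R) :
  0 < e -> nbhs f [set g | pk k (g - f) < e].
Proof. by move=> e0; exists k, e; split=> // g. Qed.

Let Cinf_add_continuous : continuous (fun x : Cinf * Cinf => x.1 + x.2).
Proof.
move=> [f g] A [k [e [e0 kA]]].
have e2 : 0 < e / 2 by rewrite divr_gt0.
exists ([set h | pk k (h - f) < e / 2], [set h | pk k (h - g) < e / 2]).
  by split; exact: nbhs_pk.
move=> [u v] [/= uf vg]; apply: kA => /=.
by rewrite opprD addrACA (le_lt_trans (pkD _ _ _)) // (splitr e) ltrD.
Qed.

Let Cinf_scale_continuous : continuous (fun z : K^o * Cinf => z.1 *: z.2).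
Proof.
move=> [c f] A [k [e [e0 kA]]].
have c1 : 0 < absr (c : K) + 1 by rewrite ltr_wpDl // absr_ge0.
have f1 : 0 < pk k f + 1 by rewrite ltr_wpDl // pk_ge0.
pose d := Num.min 1 (e / 2 / (pk k f + 1)).
have d0 : 0 < d by rewrite lt_min ltr01 !divr_gt0.
have rd0 : 0 < of_real K d.
  by rewrite lt_def fmorph_eq0 gt_eqF //= -(rmorph0 (of_real K)) of_real_mono ltW.
exists (ball (c : K^o) (of_real K d),
        [set h | pk k (h - f) < e / 2 / (absr (c : K) + 1)]).
  split; first exact: nbhsx_ballx.
  by apply: nbhs_pk; rewrite !divr_gt0.
move=> [b g] [/= bc gf]; apply: kA => /=.
have {}bc : absr (b - c : K) < d.
  rewrite -(leW_mono (of_real_mono K)) of_real_absr.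
  by move: bc; rewrite -ball_normE /ball_ /= distrC.
have b1 : absr (b : K) <= absr (c : K) + 1.
  rewrite -[X in absr X](subrK (c : K)) (le_trans (absrD _ _)) // addrC lerD2l.
  by rewrite (le_trans (ltW bc)) // ge_min lexx.
rewrite (_ : _ - _ = b *: (g - f) + (b - c) *: f); last first.
  by rewrite scalerBr scalerBl subrKA.
rewrite (le_lt_trans (pkD _ _ _)) // !pkZ (splitr e) ltr_leD //.
  rewrite (le_lt_trans (ler_wpM2r (pk_ge0 _ _) b1)) //.
  by rewrite mulrC -ltr_pdivlMr.
rewrite (le_trans (ler_wpM2r (pk_ge0 _ _) (ltW bc))) //.
apply: (@le_trans _ _ (e / 2 / (pk k f + 1) * pk k f)).
  by rewrite ler_wpM2r ?pk_ge0 // ge_min lexx orbT.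
by rewrite -mulrA ler_piMr ?divr_ge0 ?(ltW e0) // mulrC ler_pdivrMr // mul1r lerDl.
Qed.

Lemma pk_ball_convex (f : Cinf) k (e : R) :
  convex_set ([set g | pk k (g - f) < e] : set (convex_lmodType Cinf)).
Proof.
move=> u v l /set_mem /= uf /set_mem /= vf; apply/mem_set => /=.
have l0 : 0 <= l%:num by [].
have l1 : l%:num <= 1 by [].
exact: seminorm_ball_convex (pk_seminorm k) l0 l1 uf vf.
Qed.

Lemma pk_ball_open (f : Cinf) k (e : R) :
  open [set g | pk k (g - f) < e].
Proof.
rewrite openE => g /= ge; exists k, (e - pk k (g - f)).
split=> [|h /= he]; first by rewrite subr_gt0.
rewrite -(subrKA g) (le_lt_trans (pkD _ _ _)) //.
by rewrite -ltrBrDr.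
Qed.

Let Cinf_locally_convex : exists2 B : set_system (convex_lmodType Cinf),
  (forall b, b \in B -> convex_set b) & basis (B : set_system Cinf).
Proof.
exists [set A | exists f k (e : R), A = [set g : Cinf | pk k (g - f) < e]].
  by move=> b /set_mem [f [k [e ->]]]; exact: pk_ball_convex.
split; first by move=> _ [f [k [e ->]]]; exact: pk_ball_open.
move=> f A [k [e [e0 kA]]]; exists [set g | pk k (g - f) < e] => //.
by split; [exists f, k, e|rewrite /= subrr pk0].
Qed.

(* This factory only provides the uniform structure. *)
HB.instance Definition _ := PreTopologicalLmod_isTvs.Build K Cinf
  Cinf_add_continuous Cinf_scale_continuous Cinf_locally_convex.
HB.instance Definition _ :=
  PreTopologicalNmodule_isTopologicalNmodule.Build Cinf Cinf_add_continuous.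
HB.instance Definition _ :=
  TopologicalNmodule_isTopologicalLmodule.Build K Cinf Cinf_scale_continuous.
HB.instance Definition _ := Uniform_isTvs.Build K Cinf Cinf_locally_convex.

Lemma smooth_derive1 (f : Cinf) : smooth (derive1 (f : R -> realified K)).
Proof.
apply/smoothP => n x; have := @derivable_derivn n.+1 f x.
by rewrite /derivn derive1Sn.
Qed.

Definition deriv_op (f : Cinf) : Cinf := MkCinf (smooth_derive1 f).

Lemma derivn_deriv_op n (f : Cinf) : derivn n (deriv_op f) = derivn n.+1 f.
Proof. by rewrite /derivn derive1Sn. Qed.

Lemma deriv_op_is_linear : linear deriv_op.
Proof.
move=> c f g; apply/val_inj/funext => x; exact: (derivn_lin 1 c f g x).
Qed.

HB.instance Definition _ :=
  GRing.isLinear.Build K Cinf Cinf *:%R deriv_op deriv_op_is_linear.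

Lemma pk_deriv_op k (f : Cinf) : pk k (deriv_op f) <= pk k.+1 f.
Proof.
rewrite /pk [leRHS]big_ord_recl; apply: ler_wpDl; first exact: sup_derivn_ge0.
rewrite ler_sum // => l _; apply: sup_derivn_le => x xk.
rewrite derivn_deriv_op lift0; apply: sup_derivn_ub; move: xk.
rewrite !in_itv /= => /andP[x1 x2].
have kS : k%:R <= k.+1%:R :> R by rewrite ler_nat.
by rewrite (le_trans x2 kS) (le_trans _ x1) // lerN2.
Qed.

Lemma deriv_op_continuous : continuous deriv_op.
Proof.
move=> f A [k [e [e0 kA]]]; exists k.+1, e; split=> // g /= ge.
by apply: kA; rewrite /= -linearB (le_lt_trans (pk_deriv_op _ _)).
Qed.

Definition polyD (P : {poly K}) (f : Cinf) : Cinf :=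
  \sum_(i < size P) P`_i *: iter i deriv_op f.

Lemma iter_deriv_op_linear n : linear (iter n deriv_op).
Proof. by elim: n => [//|n IHn] c f g; rewrite /= IHn linearP. Qed.

Lemma polyD_is_linear (P : {poly K}) : linear (polyD P).
Proof.
move=> c f g; rewrite /polyD scaler_sumr -big_split; apply: eq_bigr => i _ /=.
by rewrite iter_deriv_op_linear scalerDr !scalerA mulrC.
Qed.

HB.instance Definition _ (P : {poly K}) :=
  GRing.isLinear.Build K Cinf Cinf *:%R (polyD P) (polyD_is_linear P).

Lemma bounded_continuous (T : {linear Cinf -> Cinf}) :
  (forall k, exists m (C : R), forall f, pk k (T f) <= C * pk m f) ->
  continuous T.
Proof.
move=> Tb f A [k [e [e0 kA]]]; have [m [C TC]] := Tb k.
have C1 : 0 < Num.max C 0 + 1 by rewrite ltr_wpDl // le_max lexx orbT.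
exists m, (e / (Num.max C 0 + 1)); split; first exact: divr_gt0.
move=> g /= ge; apply: kA => /=; rewrite -linearB (le_lt_trans (TC _)) //.
move: ge; rewrite ltr_pdivlMr // mulrC; apply: le_lt_trans.
by rewrite ler_wpM2r ?pk_ge0 // ler_wpDr // le_max lexx.
Qed.

Lemma pk_iter_deriv_op k n (f : Cinf) :
  pk k (iter n deriv_op f) <= pk (k + n) f.
Proof.
elim: n k => [|n IHn] k; first by rewrite addn0.
by rewrite iterS (le_trans (pk_deriv_op _ _)) // addnS -addSn.
Qed.

Lemma polyD_continuous (P : {poly K}) : continuous (polyD P).
Proof.
apply: bounded_continuous => k; exists (k + size P)%N.
exists (\sum_(i < size P) absr (P`_i : K)) => f.
rewrite mulr_suml /= /polyD.
have pk_sum n (F : 'I_n -> Cinf) :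
    pk k (\sum_(i < n) F i) <= \sum_(i < n) pk k (F i).
  apply: (big_ind2 (fun u v => pk k u <= v)) => // [|u1 v1 u2 v2 h1 h2].
    by rewrite pk0.
  by rewrite (le_trans (pkD _ _ _)) // lerD.
rewrite (le_trans (pk_sum _ _)) // ler_sum // => i _.
rewrite pkZ ler_wpM2l ?absr_ge0 // (le_trans (pk_iter_deriv_op _ _ _)) //.
by rewrite pk_mono // leq_add2l ltnW.
Qed.

End smooth_functions.

(* Main.v *)
Require Import Defs.
From HB Require Import structures.
From mathcomp Require Import all_boot all_order all_algebra.
From mathcomp Require Import all_classical all_reals all_analysis.
From mathcomp Require Import complex.
From mathcomp Require Import zify ring lra.

Set Implicit Arguments.
Unset Strict Implicit.
Unset Printing Implicit Defensive.

Import Order.TTheory GRing.Theory Num.Theory.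
Import numFieldNormedType.Exports.

Local Open Scope classical_set_scope.
Local Open Scope ring_scope.

(** * Why hypercyclic subspaces exist for differential operators

Write a function as [sum_l c_l x^l / l!].  In these exponential coefficients
differentiation is the shift of [c], integration from the origin is, for
polynomials, multiplication by ['X], and [enorm r c = sum_l |c_l| r^l / l!] is
submultiplicative and controls the seminorms [pk k] as soon as [k + 1 <= r].

The operator [P(D)] of order [d] has a right inverse that multiplies by ['X^d]
and by an approximate inverse of the reversed polynomial of [P].  Its [n]-th
power has norm of order [A^n / n!], whereas [P(D)^n f] grows only geometrically
for a polynomial [f].  Hence each polynomial [f] becomes, after a small
polynomial perturbation [u], a vector with [P(D)^n (f + u)] close to any
prescribed target, for all large [n] ([small_solution]).

By induction this yields vectors [f_i = x^(m_i) + sum_(s >= i) u_(s,i)] and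
powers [n_s] such that [P(D)^(n_s)] sends the combination [sum_i a_i f_i] close
to [a_(j s) w_s], where [(j s, w s)] runs infinitely often through all pairs of
an index and a polynomial with rational coordinates ([construction],
[power_vec]).  Two features make this work for infinite combinations.  The
exponent [m_s] is chosen after [n_t] for [t < s], so large that [P(D)^(n_t)]
costs at most a factor [2^(m_s)] on [x^(m_s)], which is absorbed by
an increase of the radius.  And the exponents are so lacunary that the
coefficients are controlled by the function: [|a_i| k^(m_i) <= C_k pk k F]
for [F = sum_i a_i f_i] ([coef_bound]).

By this bound the space of all [sum_i a_i f_i] with [|a_i| k^(m_i)] bounded for
every [k] is closed ([closed_hspan]), and [pk 1] vanishes on none of its nonzero
vectors, so it is of type 1.  The exponents [m_i] also avoid the degrees of all
perturbations; so the derivatives of order [m_i] at the origin are functionals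
biorthogonal to the [f_i], up to factorials, and the space has infinite
dimension.  A nonzero vector has some [a_i != 0], and its orbit comes close to [a_i w] for
all [w] with rational coordinates; these are dense by Weierstrass' theorem for
the highest derivative followed by integration ([ratpoly_smooth_of_dense]). *)

(** * The absolute value of the scalars *)

Section absolute_value.
Context {R : realType} {K : scalars R}.
Implicit Types x y : K.

Lemma absr0 : absr (0 : K) = 0.
Proof. by rewrite -(rmorph0 (of_real K)) absr_of_real normr0. Qed.

Lemma absr1 : absr (1 : K) = 1.
Proof. by rewrite -(rmorph1 (of_real K)) absr_of_real normr1. Qed.

Lemma absrN x : absr (- x) = absr x.
Proof. exact: (normrN (x : realified K)). Qed.

Lemma absrV x : absr x^-1 = (absr x)^-1.
Proof.
apply: (fmorph_inj (of_real K)).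
by rewrite fmorphV !of_real_absr normfV.
Qed.

Lemma absr_nat n : absr (n%:R : K) = n%:R.
Proof. by rewrite -(rmorph_nat (of_real K)) absr_of_real normr_nat. Qed.

Lemma absr_gt0 x : x != 0 -> 0 < absr x.
Proof.
move=> x0; rewrite lt_def absr_ge0 andbT.
by apply: contra x0 => /eqP /absr0_eq0 ->.
Qed.

Lemma absr_sum (I : Type) (s : seq I) (p : pred I) (F : I -> K) :
  absr (\sum_(i <- s | p i) F i) <= \sum_(i <- s | p i) absr (F i).
Proof.
apply: (big_ind2 (fun u v => absr u <= v)) => //; first by rewrite absr0.
by move=> x1 v1 x2 v2 h1 h2; rewrite (le_trans (absrD _ _)) // lerD.
Qed.

End absolute_value.

(** * Weighted norms of polynomials *)

Section weighted_norm.
Context {R : realType} {K : scalars R} (om : nat -> R).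
Hypothesis om_ge0 : forall l, 0 <= om l.
Implicit Types b c : {poly K}.

Definition wnorm (b : {poly K}) : R := \sum_(l < size b) absr b`_l * om l.

Lemma wnorm_widen L b : (size b <= L)%N ->
  wnorm b = \sum_(l < L) absr b`_l * om l.
Proof.
move=> sL; rewrite /wnorm (big_ord_widen _ (fun l => absr b`_l * om l) sL).
rewrite [RHS](bigID (fun l : 'I_L => (l < size b)%N)) /= [X in _ + X]big1 ?addr0 //.
by move=> l; rewrite -leqNgt => /(nth_default 0) ->; rewrite absr0 mul0r.
Qed.

Lemma wnorm_ge0 b : 0 <= wnorm b.
Proof. by apply: sumr_ge0 => l _; rewrite mulr_ge0 ?absr_ge0. Qed.

Lemma le_wnorm_partial L b : \sum_(l < L) absr b`_l * om l <= wnorm b.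
Proof.
rewrite (@wnorm_widen (maxn L (size b))) ?leq_maxr //.
rewrite (big_ord_widen (maxn L (size b)) (fun l => absr b`_l * om l)) ?leq_maxl //.
rewrite [leRHS](bigID (fun l : 'I__ => (l < L)%N)) /= lerDl.
by apply: sumr_ge0 => l _; rewrite mulr_ge0 ?absr_ge0.
Qed.

Lemma wnorm0 : wnorm 0 = 0.
Proof. by rewrite /wnorm size_poly0 big_ord0. Qed.

Lemma wnormD b c : wnorm (b + c) <= wnorm b + wnorm c.
Proof.
pose L := maxn (size b) (size c).
rewrite !(@wnorm_widen L) ?leq_maxl ?leq_maxr ?size_polyD // -big_split /=.
apply: ler_sum => l _; rewrite coefD -mulrDl ler_wpM2r //; exact: absrD.
Qed.

Lemma wnormZ a b : wnorm (a *: b) = absr a * wnorm b.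
Proof.
rewrite (@wnorm_widen (size b)) ?size_scale_leq // mulr_sumr.
by apply: eq_bigr => l _; rewrite coefZ absrM mulrA.
Qed.

Lemma wnormN b : wnorm (- b) = wnorm b.
Proof. by rewrite -scaleN1r wnormZ absrN absr1 mul1r. Qed.

Lemma wnormB b c : wnorm (b - c) <= wnorm b + wnorm c.
Proof. by rewrite (le_trans (wnormD _ _)) // wnormN. Qed.

Lemma wnorm_sum (I : Type) (s : seq I) (p : pred I) (F : I -> {poly K}) :
  wnorm (\sum_(i <- s | p i) F i) <= \sum_(i <- s | p i) wnorm (F i).
Proof.
apply: (big_ind2 (fun u v => wnorm u <= v)) => //; first by rewrite wnorm0.
by move=> x1 v1 x2 v2 h1 h2; rewrite (le_trans (wnormD _ _)) // lerD.
Qed.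

Lemma wnorm_Xn n : wnorm 'X^n = om n.
Proof.
rewrite /wnorm size_polyXn big_ord_recr /= coefXn eqxx absr1 mul1r big1 ?add0r //.
by move=> i _; rewrite coefXn ltn_eqF // absr0 mul0r.
Qed.

(** Submultiplicative weights give a submultiplicative norm. *)
Lemma wnormM b c : (forall i j, om (i + j) <= om i * om j) ->
  wnorm (b * c) <= wnorm b * wnorm c.
Proof.
move=> omM; rewrite -{1}(coefK b) poly_def mulr_suml.
rewrite (le_trans (wnorm_sum _ _ _)) // [leRHS]mulr_suml.
apply: ler_sum => i _; rewrite -scalerAl wnormZ -mulrA.
rewrite ler_wpM2l ?absr_ge0 //.
have sXc : (size ('X^i * c)%R <= i + size c)%N.
  by rewrite (leq_trans (size_polyMleq _ _)) // size_polyXn.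
rewrite (wnorm_widen sXc) big_split_ord /= big1 ?add0r.
  rewrite /wnorm mulr_sumr; apply: ler_sum => l _.
  rewrite coefXnM ltnNge leq_addr /= addKn mulrCA ler_wpM2l ?absr_ge0 //.
by move=> l _; rewrite coefXnM ltn_ord absr0 mul0r.
Qed.

End weighted_norm.

(** * Norms of exponential coefficients *)

Section exponential_norm.
Context {R : realType} {K : scalars R}.
Implicit Types (b c : {poly K}) (r : R).

Definition ewt r l : R := r ^+ l / l`!%:R.

Definition enorm r b := wnorm (ewt r) b.

Lemma ewt_ge0 r l : 0 <= r -> 0 <= ewt r l.
Proof. by move=> r0; rewrite /ewt mulr_ge0 ?exprn_ge0 // invr_ge0. Qed.

Lemma fact_gt0R n : 0 < n`!%:R :> R.
Proof. by rewrite ltr0n fact_gt0. Qed.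

Lemma ewt_mono r s l : 0 <= r -> r <= s -> ewt r l <= ewt s l.
Proof.
by move=> r0 rs; rewrite /ewt ler_wpM2r ?invr_ge0 // lerXn2r ?nnegrE // (le_trans r0).
Qed.

Lemma fact_addn i j : (i`! * j`! <= (i + j)`!)%N.
Proof.
rewrite -(bin_fact (leq_addr j i)) addKn leq_pmull // bin_gt0 leq_addr //.
Qed.

Lemma ewtD r i j : 0 <= r -> ewt r (i + j) <= ewt r i * ewt r j.
Proof.
move=> r0; rewrite /ewt exprD mulrACA -invfM -natrM ler_wpM2l //.
  by rewrite mulr_ge0 ?exprn_ge0.
by rewrite lef_pV2 ?posrE ?ltr0n ?muln_gt0 ?fact_gt0 // ler_nat fact_addn.
Qed.

(** Bound for an [i]-th derivative: shifting the coefficients by [i] costs a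
    factor [i`!] and an increase of the radius by one. *)
Lemma ewt_shift r l i : 0 <= r -> ewt r l <= i`!%:R * ewt (r + 1) (l + i).
Proof.
move=> r0; rewrite /ewt mulrCA ler_pdivrMr ?fact_gt0R //.
have -> : (r + 1) ^+ (l + i) * (i`!%:R / (l + i)`!%:R) * l`!%:R =
    (r + 1) ^+ (l + i) / 'C(l + i, i)%:R.
  rewrite -(bin_fact (leq_addl l i)) addnK !natrM.
  have := fact_gt0R i; have := fact_gt0R l.
  have : 0 < 'C(l + i, i)%:R :> R by rewrite ltr0n bin_gt0 leq_addl.
  by move=> /lt0r_neq0 h1 /lt0r_neq0 h2 /lt0r_neq0 h3; field; rewrite h1 h2 h3.
rewrite ler_pdivlMr ?ltr0n ?bin_gt0 ?leq_addl //.
rewrite exprDn addnC.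
have := ltn_ord (inord i : 'I_(i + l).+1).
rewrite (bigD1 (inord i : 'I_(i + l).+1)) //= inordK ?ltnS ?leq_addr //.
rewrite expr1n mulr1 addKn mulr_natr lerDl => _.
by apply: sumr_ge0 => j _; rewrite mulrn_wge0 // mulr_ge0 ?exprn_ge0.
Qed.

Lemma enormM r b c : 0 <= r -> enorm r (b * c) <= enorm r b * enorm r c.
Proof.
move=> r0; apply: wnormM => [l|i j]; [exact: ewt_ge0|exact: ewtD].
Qed.

Lemma enorm_ge0 r b : 0 <= r -> 0 <= enorm r b.
Proof. by move=> r0; apply: wnorm_ge0 => l; exact: ewt_ge0. Qed.

Lemma enorm1 r : enorm r (1 : {poly K}) = 1.
Proof. by rewrite /enorm -(expr0 'X) wnorm_Xn /ewt expr0 fact0 invr1 mulr1. Qed.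

Lemma enormX r b n : 0 <= r -> enorm r (b ^+ n) <= enorm r b ^+ n.
Proof.
move=> r0; elim: n => [|n IHn]; first by rewrite !expr0 enorm1.
by rewrite !exprS (le_trans (enormM _ _ r0)) // ler_wpM2l ?enorm_ge0.
Qed.

Lemma enorm_le_radius r s b : 0 <= r -> r <= s -> enorm r b <= enorm s b.
Proof.
move=> r0 rs; apply: ler_sum => l _; rewrite ler_wpM2l ?absr_ge0 //.
exact: ewt_mono.
Qed.

(** The factor 3 is crude: one more factor [1 - b] at most doubles the error and
    adds [enorm r b], and [2 * 3 ^ n + 1 <= 3 ^ n.+1]. *)
Lemma enorm_expand_sub1 r b n : 0 <= r -> enorm r b <= 1 ->
  enorm r ((1 - b) ^+ n - 1) <= 3 ^+ n * enorm r b.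
Proof.
move=> r0 b1; have b0 := enorm_ge0 b r0.
elim: n => [|n IHn]; first by rewrite !expr0 subrr /enorm wnorm0 mul1r.
have -> : (1 - b) ^+ n.+1 - 1 = ((1 - b) ^+ n - 1) * (1 - b) - b.
  by rewrite exprSr; ring.
have h1 : enorm r (1 - b) <= 2.
  rewrite (le_trans (wnormB _ _ _)) //; first by move=> l; exact: ewt_ge0.
  by rewrite -!/(enorm _ _) enorm1; lra.
have h2 : enorm r (((1 - b) ^+ n - 1) * (1 - b)) <= 3 ^+ n * enorm r b * 2.
  rewrite (le_trans (enormM _ _ r0)) // ler_pM ?enorm_ge0 //.
rewrite (le_trans (wnormB _ _ _)) //; first by move=> l; exact: ewt_ge0.
rewrite -!/(enorm _ _).
have h3 : 1 <= 3 ^+ n :> R by rewrite exprn_ege1 // ler1n.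
have h4 : enorm r b <= 3 ^+ n * enorm r b by rewrite ler_peMl.
rewrite exprSr; lra.
Qed.

End exponential_norm.

(** * Differential operators on exponential coefficients *)

Section differential_operator.
Context {R : realType} {K : scalars R}.
Implicit Types (P Q b : {poly K}) (c : nat -> K).

(** The exponential coefficients of [Q(D) F], when [c] are those of [F]. *)
Definition Ts Q c : nat -> K := fun l => \sum_(i < size Q) Q`_i * c (l + i)%N.

Lemma Ts_widen L Q c l : (size Q <= L)%N ->
  Ts Q c l = \sum_(i < L) Q`_i * c (l + i)%N.
Proof.
move=> sL; rewrite /Ts (big_ord_widen _ (fun i => Q`_i * c (l + i)%N) sL).
rewrite [RHS](bigID (fun i : 'I_L => (i < size Q)%N)) /= [X in _ + X]big1 ?addr0 //.
by move=> i; rewrite -leqNgt => /(nth_default 0) ->; rewrite mul0r.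
Qed.

Lemma TsD P Q c l : Ts (P + Q) c l = Ts P c l + Ts Q c l.
Proof.
pose L := maxn (size P) (size Q).
rewrite !(@Ts_widen L) ?leq_maxl ?leq_maxr ?size_polyD // -big_split /=.
by apply: eq_bigr => i _; rewrite coefD mulrDl.
Qed.

Lemma TsZ a Q c l : Ts (a *: Q) c l = a * Ts Q c l.
Proof.
rewrite (@Ts_widen (size Q)) ?size_scale_leq // mulr_sumr.
by apply: eq_bigr => i _; rewrite coefZ mulrA.
Qed.

Lemma Ts0 c l : Ts 0 c l = 0.
Proof. by rewrite /Ts size_poly0 big_ord0. Qed.

Lemma TsXn n Q c l : Ts ('X^n * Q) c l = Ts Q c (l + n)%N.
Proof.
have s : (size ('X^n * Q)%R <= n + size Q)%N.
  by rewrite (leq_trans (size_polyMleq _ _)) // size_polyXn.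
rewrite (Ts_widen _ _ s) big_split_ord /= big1 ?add0r.
  by apply: eq_bigr => i _; rewrite coefXnM ltnNge leq_addr /= addKn addnA.
by move=> i _; rewrite coefXnM ltn_ord mul0r.
Qed.

(** Polynomials act on sequences through the shift, so the powers of [P(D)] are
    the single operators attached to [P ^+ n]. *)
Lemma TsM P Q c l : Ts (P * Q) c l = Ts P (Ts Q c) l.
Proof.
rewrite -{1}(coefK P) poly_def mulr_suml {2}/Ts.
rewrite (big_morph (fun q => Ts q c l) (id1 := 0) (op1 := +%R)).
- by apply: eq_bigr => i _; rewrite -scalerAl TsZ TsXn.
- by move=> x y; exact: TsD.
- exact: Ts0.
Qed.

Lemma Ts1 c l : Ts 1 c l = c l.
Proof. by rewrite /Ts size_poly1 big_ord1 coef1 eqxx mul1r addn0. Qed.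

Lemma Ts_eq Q c c' l M : (forall i, (i < M)%N -> c i = c' i) ->
  (l + size Q <= M)%N -> Ts Q c l = Ts Q c' l.
Proof.
move=> cc' lM; apply: eq_bigr => i _; rewrite cc' //.
by rewrite (leq_trans _ lM) // ltn_add2l.
Qed.

Lemma Ts_linr Q a c c' l :
  Ts Q (fun i => a * c i + c' i) l = a * Ts Q c l + Ts Q c' l.
Proof.
rewrite /Ts mulr_sumr -big_split; apply: eq_bigr => i _ /=.
by rewrite mulrDr mulrCA.
Qed.

(** [Ts] on finite sequences: differentiation does not raise the size. *)
Definition Tp Q b : {poly K} := \poly_(l < size b) Ts Q (fun l => b`_l) l.

Lemma coef_Tp Q b l : (Tp Q b)`_l = Ts Q (fun l => b`_l) l.
Proof.
rewrite coef_poly; case: ltnP => // sl; rewrite /Ts big1 // => i _.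
by rewrite (nth_default 0 (leq_trans sl (leq_addr _ _))) mulr0.
Qed.

Lemma Tp_is_linear Q : linear (Tp Q).
Proof.
move=> a b c; apply/polyP => l; rewrite coefD coefZ !coef_Tp -Ts_linr.
by apply: eq_bigr => i _; rewrite coefD coefZ.
Qed.

HB.instance Definition _ Q :=
  GRing.isLinear.Build K {poly K} {poly K} *:%R (Tp Q) (Tp_is_linear Q).

Lemma TpM P Q b : Tp (P * Q) b = Tp P (Tp Q b).
Proof.
apply/polyP => l; rewrite !coef_Tp TsM; apply: eq_bigr => i _.
by rewrite coef_Tp.
Qed.

Lemma Tp1 b : Tp 1 b = b.
Proof. by apply/polyP => l; rewrite coef_Tp Ts1. Qed.

Definition revp P := \poly_(i < size P) P`_((size P).-1 - i).

(** In exponential coefficients integration is multiplication by ['X], so on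
    functions that vanish to order [d] at the origin a differential operator
    of order [d] is multiplication by the reversed polynomial. *)
Lemma Tp_Xn P b : Tp P ('X^((size P).-1) * b) = revp P * b.
Proof.
apply/polyP => l; rewrite coef_Tp /revp poly_def mulr_suml coef_sum /Ts.
have [->|P0] := eqVneq P 0; first by rewrite size_poly0 !big_ord0.
have sP : (0 < size P)%N by rewrite lt0n size_poly_eq0.
rewrite (reindex_inj rev_ord_inj) /=; apply: eq_bigr => i _.
rewrite -scalerAl coefZ !coefXnM -subn1 subnBA // !subn1.
have iP : (i <= (size P).-1)%N by rewrite -ltnS prednK.
have -> : (size P - i.+1 = (size P).-1 - i)%N by rewrite -subn1 -subnDA add1n.
rewrite addn1 /=.
congr (_ * _).
have -> : (l + ((size P).-1 - i) < (size P).-1)%N = (l < i)%N.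
  by rewrite -{2}(subnK iP) addnC ltn_add2l.
case: ltnP => // il; congr (b`_ _).
by rewrite -[X in (_ - X)%N](prednK sP) subSS addnBA // subnAC addnK.
Qed.

Lemma Tp_Xn_iter P n b :
  Tp (P ^+ n) ('X^((size P).-1 * n) * b) = revp P ^+ n * b.
Proof.
elim: n b => [|n IHn] b; first by rewrite muln0 !expr0 !mul1r Tp1.
rewrite exprSr TpM mulnS exprD -mulrA Tp_Xn mulrCA IHn exprSr mulrCA.
by rewrite mulrA [revp P * _]mulrC.
Qed.

(** The plain sum of absolute values gives the geometric growth rate of the
    iterates of an operator, independently of the degree of the argument. *)
Lemma wnorm1_Tp Q b :
  wnorm (fun=> 1) (Tp Q b) <= (\sum_(i < size Q) absr Q`_i) * wnorm (fun=> 1) b.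
Proof.
rewrite (@wnorm_widen _ _ _ (size b)) ?size_poly // mulr_suml.
apply: (@le_trans _ _
  (\sum_(l < size b) \sum_(i < size Q) absr Q`_i * absr b`_(l + i))).
  apply: ler_sum => l _; rewrite mulr1 coef_Tp (le_trans (absr_sum _ _ _)) //.
  by apply: ler_sum => i _; rewrite absrM.
rewrite exchange_big; apply: ler_sum => i _ /=; rewrite -mulr_sumr.
rewrite ler_wpM2l ?absr_ge0 //.
rewrite (@wnorm_widen _ _ _ (i + size b)) ?leq_addl // big_split_ord /=.
rewrite ler_wpDl //; first by apply: sumr_ge0 => l _; rewrite mulr1 absr_ge0.
by apply: ler_sum => l _; rewrite mulr1 addnC.
Qed.

(** The cost of [Q(D)] in passing from radius [r + 1] to radius [r].  One unit of
    radius pays for derivatives of all orders, so no radius is lost by taking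
    powers of the operator. *)
Definition Tcost Q : R := \sum_(i < size Q) absr Q`_i * i`!%:R.

Lemma Tcost_ge0 Q : 0 <= Tcost Q.
Proof. by apply: sumr_ge0 => i _; rewrite mulr_ge0 ?absr_ge0. Qed.

Lemma enorm_Tp r Q b : 0 <= r -> enorm r (Tp Q b) <= Tcost Q * enorm (r + 1) b.
Proof.
move=> r0; have r1 : 0 <= r + 1 by rewrite addr_ge0.
rewrite /enorm (@wnorm_widen _ _ _ (size b)) ?size_poly // mulr_suml.
apply: (@le_trans _ _
  (\sum_(l < size b) \sum_(i < size Q) absr Q`_i * (absr b`_(l + i) * ewt r l))).
  apply: ler_sum => l _; rewrite coef_Tp.
  under [leRHS]eq_bigr do rewrite mulrA.
  rewrite -mulr_suml ler_wpM2r ?ewt_ge0 // (le_trans (absr_sum _ _ _)) //.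
  by apply: ler_sum => i _; rewrite absrM.
rewrite exchange_big; apply: ler_sum => i _ /=; rewrite -mulr_sumr -mulrA.
rewrite ler_wpM2l ?absr_ge0 //.
rewrite (@wnorm_widen _ _ _ (i + size b)) ?leq_addl // big_split_ord /= mulrDr.
rewrite ler_wpDl //.
  by rewrite mulr_ge0 // sumr_ge0 // => l _; rewrite mulr_ge0 ?absr_ge0 ?ewt_ge0.
rewrite mulr_sumr; apply: ler_sum => l _; rewrite addnC [leRHS]mulrCA.
by rewrite ler_wpM2l ?absr_ge0 // [(i + l)%N]addnC ewt_shift.
Qed.

End differential_operator.

(** * Small right inverses of powers of the operator *)

Section small_solution.
Context {R : realType} {K : scalars R}.
Implicit Types (P b f w v : {poly K}).

(** The partial sums of the exponential series increase to the exponential. *)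
Lemma sum_ewt_le (r : R) L : 0 <= r -> \sum_(l < L) ewt r l <= expR r.
Proof.
move=> r0; rewrite -(big_mkord xpredT (ewt r)).
apply: (nondecreasing_cvgn_le _ (is_cvg_series_exp_coeff r) L).
apply/nondecreasing_seqP => n; rewrite /series /= big_nat_recr //= lerDl.
exact: ewt_ge0.
Qed.

Lemma ewt_le_expR (r : R) l : 0 <= r -> ewt r l <= expR r.
Proof.
move=> r0; rewrite (le_trans _ (sum_ewt_le l.+1 r0)) // big_ord_recr /= lerDr.
by apply: sumr_ge0 => i _; exact: ewt_ge0.
Qed.

Lemma ewt_eventually_le (A B e : R) : 0 < e -> 0 <= A -> 0 <= B ->
  exists N, forall n, (N <= n)%N -> ewt A n * B <= e.
Proof.
move=> e0 A0 B0; have B1 : 0 < B + 1 by rewrite ltr_wpDl.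
have := cvgr0_norm_lt _ (cvg_exp_coeff A) _ (divr_gt0 e0 B1).
move=> [N _ NP]; exists N => n Nn.
have := NP n Nn; rewrite /= ger0_norm; last exact: (ewt_ge0 n A0).
rewrite ltr_pdivlMr // => /ltW; apply: le_trans.
by rewrite ler_wpM2l ?lerDl //; exact: ewt_ge0.
Qed.

(** The weights [r ^ l / l!] are bounded, which makes the comparison independent
    of the degree. *)
Lemma enorm_le_wnorm1 (r : R) b : 0 <= r ->
  enorm r b <= expR r * wnorm (fun=> 1) b.
Proof.
move=> r0; rewrite mulr_sumr; apply: ler_sum => l _.
by rewrite [leRHS]mulrCA mulr1 ler_wpM2l ?absr_ge0 ?ewt_le_expR.
Qed.

Lemma wnorm1_Tp_iter P n b : wnorm (fun=> 1) (Tp (P ^+ n) b) <=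
  (\sum_(i < size P) absr P`_i) ^+ n * wnorm (fun=> 1) b.
Proof.
elim: n b => [|n IHn] b; first by rewrite !expr0 Tp1 mul1r.
rewrite exprS TpM (le_trans (wnorm1_Tp _ _)) // exprS -mulrA ler_wpM2l //.
by apply: sumr_ge0 => i _; exact: absr_ge0.
Qed.

(** The reversed polynomial of [P] is [c (1 - W)] with [W] divisible by ['X].
    Powers of ['X] have tiny norms, so the truncated Neumann series inverts
    it up to an arbitrarily small error, with a norm bounded independently of
    the truncation. *)
Lemma revp_inverse P (r : R) : (1 < size P)%N -> 0 <= r ->
  exists2 z : R, 0 <= z & forall e, 0 < e ->
    exists h g : {poly K}, [/\ enorm r h <= z, enorm r g <= e &
      revp P * h = 1 - g].
Proof.
move=> sP r0; set c := lead_coef P.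
have c0 : c != 0 by rewrite lead_coef_eq0 -size_poly_gt0 (ltn_trans _ sP).
pose W := 1 - c^-1 *: revp P.
have : root W 0.
  rewrite /root /W -[_.[0]]/(horner _ _) horner_coef0 coefB coef1 coefZ coef_poly.
  by rewrite (ltn_trans _ sP) // subn0 mulVf // subrr.
move=> /factor_theorem [W']; rewrite subr0 => WE.
pose be := enorm r W'; have be0 : 0 <= be by exact: enorm_ge0.
have rb0 : 0 <= r * be by rewrite mulr_ge0.
have NW l : enorm r (W ^+ l) <= ewt (r * be) l.
  rewrite WE exprMn mulrC (le_trans (enormM _ _ r0)) //.
  have -> : ewt (r * be) l = ewt r l * be ^+ l by rewrite /ewt exprMn mulrAC.
  by rewrite [X in X * _]wnorm_Xn ler_wpM2l ?ewt_ge0 // enormX.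
exists (absr c^-1 * expR (r * be)) => [|e e0].
  by rewrite mulr_ge0 ?absr_ge0 // expR_ge0.
have [L LP] := ewt_eventually_le e0 rb0 ler01.
exists (c^-1 *: \sum_(l < L) W ^+ l), (W ^+ L); split.
- rewrite [leLHS]wnormZ ler_wpM2l ?absr_ge0 //.
  rewrite (le_trans (wnorm_sum _ _ _ _)) //; first by move=> l; exact: ewt_ge0.
  by apply: le_trans (sum_ewt_le L rb0); apply: ler_sum => i _; exact: NW.
- by have := LP L (leqnn L); rewrite mulr1; apply: le_trans.
- rewrite -scalerAr scalerAl.
  rewrite (_ : c^-1 *: revp P = 1 - W); last by rewrite /W opprB addrC subrK.
  by rewrite -[1 - W]opprB mulNr -subrX1 opprB.
Qed.

Lemma ewt_muln (r : R) d n : (0 < d)%N -> 0 <= r ->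
  ewt r (d * n) <= ewt (r ^+ d) n.
Proof.
move=> d0 r0; rewrite /ewt exprM ler_wpM2l ?exprn_ge0 //.
rewrite lef_pV2 ?posrE ?fact_gt0R // ler_nat; apply: leq_fact.
by rewrite leq_pmull.
Qed.

(** The [n]-fold right inverse has norm of order [A ^ n / n!], which beats the
    geometric growth of [P(D)^n f].  So a small change [u] of [f] steers
    [P(D)^n (f + u)] to the prescribed target [w]. *)
Lemma small_solution P f w (r e : R) : (1 < size P)%N -> 0 <= r -> 0 < e ->
  exists N, forall n, (N <= n)%N -> exists u : {poly K},
    [/\ forall l, (l < n)%N -> u`_l = 0, enorm r u <= e &
       enorm r (Tp (P ^+ n) (f + u) - w) <= e].
Proof.
move=> sP r0 e0; have [z z0 zP] := revp_inverse sP r0.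
pose p : R := \sum_(i < size P) absr P`_i.
have p0 : 0 <= p by apply: sumr_ge0 => i _; exact: absr_ge0.
pose d := (size P).-1; have d0 : (0 < d)%N by rewrite /d -subn1 subn_gt0.
pose B := enorm r w + expR r * wnorm (fun=> 1) f.
have w0 : 0 <= wnorm (fun=> 1) f by apply: wnorm_ge0.
have B0 : 0 <= B by rewrite addr_ge0 ?enorm_ge0 // mulr_ge0 // expR_ge0.
have A0 : 0 <= r ^+ d * z * (p + 1) by rewrite mulr_ge0 ?addr_ge0 // mulr_ge0 ?exprn_ge0.
have [N NP] := ewt_eventually_le e0 A0 B0.
exists N => n /NP nP; pose v := w - Tp (P ^+ n) f.
have vB : enorm r v <= B * (p + 1) ^+ n.
  rewrite (le_trans (wnormB _ _ _)) //; first by move=> l; exact: ewt_ge0.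
  rewrite mulrDl lerD //.
    by rewrite ler_peMr ?enorm_ge0 // exprn_ege1 // lerDr.
  rewrite (le_trans (enorm_le_wnorm1 _ r0)) // -mulrA ler_wpM2l ?expR_ge0 //.
  rewrite (le_trans (wnorm1_Tp_iter _ _ _)) // mulrC ler_wpM2l //.
  by rewrite lerXn2r ?nnegrE ?addr_ge0 // lerDl.
have Bn0 : 0 <= B * (p + 1) ^+ n by rewrite mulr_ge0 // exprn_ge0 // addr_ge0.
pose C := 3 ^+ n * (B * (p + 1) ^+ n).
have C0 : 0 <= C by rewrite mulr_ge0 ?exprn_ge0.
have C1 : 0 < C + 1 by rewrite ltr_wpDl.
(* The accuracy of the inverse may depend on n, since its norm z does not
   depend on the accuracy. *)
have [|h [g [hz ge Phg]]] := zP (Num.min 1 (e / (C + 1))).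
  by rewrite lt_min ltr01 divr_gt0.
have g0 := enorm_ge0 g r0.
move: ge; rewrite le_min => /andP[g1 ge].
exists ('X^(d * n) * (h ^+ n * v)); split.
- move=> l ln; rewrite coefXnM (leq_trans ln) // leq_pmull //.
- apply: le_trans nP; rewrite (le_trans (enormM _ _ r0)) //.
  have -> : ewt (r ^+ d * z * (p + 1)) n * B =
      ewt (r ^+ d) n * (z ^+ n * (B * (p + 1) ^+ n)).
    by rewrite /ewt !exprMn; ring.
  rewrite [X in X * _]wnorm_Xn ler_pM ?ewt_ge0 ?enorm_ge0 ?ewt_muln //.
  rewrite (le_trans (enormM _ _ r0)) // ler_pM ?enorm_ge0 //.
  rewrite (le_trans (enormX _ _ r0)) // lerXn2r ?nnegrE ?enorm_ge0 //.
- have -> : Tp (P ^+ n) (f + 'X^(d * n) * (h ^+ n * v)) - w =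
      ((1 - g) ^+ n - 1) * v.
    rewrite linearD /= Tp_Xn_iter mulrA -exprMn Phg mulrBl mul1r /v.
    by rewrite opprB addrCA addrA.
  rewrite (le_trans (enormM _ _ r0)) //.
  apply: le_trans (ler_wpM2r (enorm_ge0 v r0) (enorm_expand_sub1 n r0 g1)) _.
  rewrite (@le_trans _ _ (enorm r g * C)) //.
    rewrite /C mulrA [enorm r g * _]mulrC ler_wpM2l // mulr_ge0 ?exprn_ge0 //.
  rewrite (le_trans (ler_wpM2r C0 ge)) // -mulrA ler_piMr ?ltW //.
  by rewrite mulrC ltr_pdivrMr // mul1r ltrDl.
Qed.

End small_solution.

(** * Entire power series as smooth functions *)

Section real_power_series.
Context {R : realType}.
Implicit Types (c : nat -> R) (x r : R).

(** Infinite radius of convergence, as boundedness of the partial sums of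
    absolute values, the form in which the estimates are obtained. *)
Definition rentire c := forall r, 0 <= r ->
  exists B, forall L, \sum_(l < L) `|c l| * ewt r l <= B.

Definition rps c x : R := limn (pseries (fun l => c l / l`!%:R) x).

Lemma rentire_cvg c x : rentire c -> cvgn (pseries (fun l => c l / l`!%:R) x).
Proof.
move=> ec; have [B cB] := ec _ (normr_ge0 x).
apply: normed_cvg; apply: nondecreasing_is_cvgn.
  by apply/nondecreasing_seqP => n; rewrite /= !seriesEord /= big_ord_recr /= lerDl.
exists B => _ [L _ <-]; rewrite /= !seriesEord /=.
rewrite (le_trans _ (cB L)) // ler_sum // => l _.
by rewrite !normrM normrX normfV normr_nat /ewt mulrAC mulrA.
Qed.

Lemma rentire_shift c : rentire c -> rentire (fun l => c l.+1).
Proof.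
move=> ec r r0; have [B cB] := ec (r + 1) (addr_ge0 r0 ler01).
exists B => L; rewrite (le_trans _ (cB L.+1)) // big_ord_recl ler_wpDl //.
  by rewrite mulr_ge0 // ewt_ge0 // addr_ge0.
apply: ler_sum => l _; rewrite lift0 ler_wpM2l //.
by have := ewt_shift l 1 r0; rewrite (_ : 1`!%:R = 1 :> R) // mul1r addn1.
Qed.

Lemma is_derive_rps c x : rentire c ->
  is_derive x 1 (rps c) (rps (fun l => c l.+1) x).
Proof.
move=> ec; have ec1 := rentire_shift ec; have ec2 := rentire_shift ec1.
have diffsE d : pseries_diffs (fun l => d l / l`!%:R) =
    (fun l => d l.+1 / l`!%:R) :> (nat -> R).
  apply/funext => l; rewrite /pseries_diffs factS natrM invfM mulrCA.
  by rewrite mulVKf // pnatr_eq0.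
have xx1 : `|x| < `| `|x| + 1|.
  by rewrite [ltRHS]ger0_norm ?addr_ge0 // ltrDl.
rewrite /rps -diffsE; apply: (@pseries_snd_diffs _ _ (`|x| + 1)) => //.
- exact: rentire_cvg.
- by rewrite diffsE; exact: rentire_cvg.
- by rewrite !diffsE; exact: rentire_cvg.
Qed.

Lemma rps_cvg c x : rentire c ->
  (fun L => \sum_(l < L) c l * (x ^+ l / l`!%:R)) @ \oo --> rps c x.
Proof.
move=> ec; have /cvg_ex[/= a ca] : cvgn _ := @rentire_cvg c x ec.
rewrite /rps (cvg_lim _ ca) //.
rewrite (_ : (fun L => _) = pseries (fun l => c l / l`!%:R) x) //.
apply/funext => L; rewrite /pseries seriesEord /=.
by apply: eq_bigr => l _; rewrite mulrAC mulrA.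
Qed.

End real_power_series.

(** Coordinates of the scalars with respect to [1] and [j], where [j = 0] for the
    reals.  They transport the real theory of power series, differentiation and
    approximation to both fields. *)
Record coordinates (R : realType) (K : scalars R) := Coordinates {
  re_part : K -> R;
  im_part : K -> R;
  im_unit : K;
  coordE : forall z, z = of_real K (re_part z) + of_real K (im_part z) * im_unit;
  re_lin : forall s z w, re_part (of_real K s * z + w) = s * re_part z + re_part w;
  im_lin : forall s z w, im_part (of_real K s * z + w) = s * im_part z + im_part w;
  re_le : forall z, `|re_part z| <= absr z;
  im_le : forall z, `|im_part z| <= absr z
}.

Section entire_functions.
Context {R : realType} {K : scalars R} (co : coordinates K).
Implicit Types (c : nat -> K) (x r B : R).

Definition nbnd c r B := forall L, \sum_(l < L) absr (c l) * ewt r l <= B.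

Definition entire c := forall r, 0 <= r -> exists B, nbnd c r B.

(** The sequence version of [ewt_shift]: an [n]-th derivative costs [n!] and one
    unit of radius. *)
Lemma nbnd_shift c r B n : 0 <= r -> nbnd c (r + 1) B ->
  nbnd (fun l => c (n + l)%N) r (n`!%:R * B).
Proof.
move=> r0 cB L; have r1 : 0 <= r + 1 by rewrite addr_ge0.
rewrite (le_trans _ (ler_wpM2l (ler0n _ _) (cB (n + L)%N))) //.
rewrite big_split_ord /= mulrDr ler_wpDl //.
  by rewrite mulr_ge0 // sumr_ge0 // => l _; rewrite mulr_ge0 ?absr_ge0 ?ewt_ge0.
rewrite mulr_sumr; apply: ler_sum => l _; rewrite [leRHS]mulrCA.
by rewrite ler_wpM2l ?absr_ge0 // addnC ewt_shift.
Qed.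

Lemma entire_shift c n : entire c -> entire (fun l => c (n + l)%N).
Proof.
move=> ec r r0; have [B cB] := ec _ (addr_ge0 r0 ler01).
by exists (n`!%:R * B); exact: nbnd_shift.
Qed.

Lemma entire_re c : entire c -> rentire (fun l => re_part co (c l)).
Proof.
move=> ec r r0; have [B cB] := ec r r0; exists B => L.
rewrite (le_trans _ (cB L)) // ler_sum // => l _.
by rewrite ler_wpM2r ?ewt_ge0 // re_le.
Qed.

Lemma entire_im c : entire c -> rentire (fun l => im_part co (c l)).
Proof.
move=> ec r r0; have [B cB] := ec r r0; exists B => L.
rewrite (le_trans _ (cB L)) // ler_sum // => l _.
by rewrite ler_wpM2r ?ewt_ge0 // im_le.
Qed.

Definition pser c (x : R) : realified K :=
  rps (fun l => re_part co (c l)) x *: ((1 : K) : realified K) +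
  rps (fun l => im_part co (c l)) x *: (im_unit co : realified K).

Lemma derivable_scalel (g : R -> R) (g' x : R) (z : realified K) :
  is_derive x 1 g g' -> is_derive x 1 (fun y => g y *: z) (g' *: z).
Proof.
move=> [dg <-].
have H : (fun h : R => h^-1 *: (((fun y => g y *: z) \o shift x) (h *: 1) - g x *: z))
    @ 0^' --> 'D_1 g x *: z.
  rewrite (_ : (fun h => _) = (fun h : R =>
     (h^-1 *: ((g \o shift x) (h *: 1) - g x)) *: z)); last first.
    by apply/funext => h /=; rewrite -scalerBl scalerA.
  by apply: cvgZr_tmp; exact: dg.
apply: DeriveDef; first by apply/cvg_ex; exists ('D_1 g x *: z).
exact: cvg_lim.
Qed.

Lemma is_derive_pser c x : entire c ->
  is_derive x 1 (pser c) (pser (fun l => c l.+1) x).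
Proof.
move=> ec; apply: is_deriveD; apply: derivable_scalel; apply: is_derive_rps.
  exact: entire_re.
exact: entire_im.
Qed.

Lemma derive1n_pser c n : entire c ->
  derive1n n (pser c) = pser (fun l => c (n + l)%N).
Proof.
move=> ec; elim: n => [//|n IHn]; rewrite derive1nS IHn; apply/funext => x.
rewrite derive1E.
have := is_derive_pser x (entire_shift n ec) => /@derive_val ->.
by congr pser; apply/funext => l; rewrite addnS.
Qed.

Lemma smooth_pser c : entire c -> smooth (pser c : R -> K^o).
Proof.
move=> ec; apply/smoothP => n x; rewrite derive1n_pser //.
by have [] := is_derive_pser x (entire_shift n ec).
Qed.

End entire_functions.

Section entire_smooth.
Context {R : realType} {K : scalars R} (co : coordinates K).
Implicit Types (c : nat -> K) (b : {poly K}) (x r B : R).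

Lemma realified_scaleE r (z : realified K) : r *: z = of_real K r * (z : K).
Proof. by []. Qed.

(** The function defined through real coordinates is the sum of the power series
    over the scalars.  By uniqueness of limits it is then linear over the
    scalars, which the coordinates alone would not show. *)
Lemma pser_cvg c x : entire c ->
  (fun L => \sum_(l < L) (x ^+ l / l`!%:R) *: (c l : realified K)) @ \oo -->
    pser co c x.
Proof.
move=> ec; rewrite (_ : (fun L => _) = (fun L =>
  (\sum_(l < L) re_part co (c l) * (x ^+ l / l`!%:R)) *: ((1 : K) : realified K) +
  (\sum_(l < L) im_part co (c l) * (x ^+ l / l`!%:R)) *:
     (im_unit co : realified K))); last first.
  apply/funext => L; rewrite !scaler_suml -big_split; apply: eq_bigr => l _ /=.
  rewrite {1}(coordE co (c l)) scalerDr; congr (_ + _).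
    rewrite [in RHS]mulrC -[RHS]scalerA; congr (_ *: _).
    by rewrite realified_scaleE mulr1.
  by rewrite [in RHS]mulrC -[RHS]scalerA.
apply: cvgD; apply: cvgZr_tmp; apply: rps_cvg.
  exact: entire_re.
exact: entire_im.
Qed.

Lemma realified_cvg_unique (u : nat -> realified K) (y z : realified K) :
  u @ \oo --> y -> u @ \oo --> z -> y = z.
Proof. by move=> uy uz; rewrite -(cvg_lim _ uy) // -(cvg_lim _ uz). Qed.

Lemma pser_lin a c c' x : entire c -> entire c' ->
  entire (fun l => a * c l + c' l) ->
  pser co (fun l => a * c l + c' l) x = (a : K) * pser co c x + pser co c' x.
Proof.
move=> ec ec' ecc'; apply: realified_cvg_unique (@pser_cvg _ x ecc') _.
rewrite (_ : (fun L => _) = (fun L =>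
  (a * (\sum_(l < L) (x ^+ l / l`!%:R) *: (c l : realified K)) : realified K) +
  \sum_(l < L) (x ^+ l / l`!%:R) *: (c' l : realified K))); last first.
  apply/funext => L; rewrite mulr_sumr -big_split; apply: eq_bigr => l _ /=.
  by rewrite scalerDr; congr (_ + _); exact: mulrCA.
apply: cvgD; last exact: pser_cvg.
exact: (cvg_comp _ _ (@pser_cvg _ x ec) (@mull_continuous _ _ a _)).
Qed.

Lemma entire_lin a c c' : entire c -> entire c' ->
  entire (fun l => a * c l + c' l).
Proof.
move=> ec ec' r r0; have [B cB] := ec r r0; have [B' cB'] := ec' r r0.
exists (absr a * B + B') => L; rewrite (le_trans _ (lerD (ler_wpM2l (absr_ge0 a) (cB L)) (cB' L))) //.
rewrite mulr_sumr -big_split; apply: ler_sum => l _ /=.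
by rewrite [X in _ <= X + _]mulrA -mulrDl ler_wpM2r ?ewt_ge0 // -absrM absrD.
Qed.

Lemma entire0 : entire (fun=> 0 : K).
Proof. by move=> r r0; exists 0 => L; rewrite big1 // => l _; rewrite absr0 mul0r. Qed.

Lemma norm_pser_le c x r B : entire c -> `|x| <= r -> nbnd c r B ->
  `|pser co c x| <= B.
Proof.
move=> ec xr cB; have /cvg_norm vc := @pser_cvg _ x ec.
rewrite -(cvg_lim _ vc) //; apply: limr_le; first by apply/cvg_ex; eexists; exact: vc.
near=> L; rewrite (le_trans (ler_norm_sum _ _ _)) // (le_trans _ (cB L)) //.
apply: ler_sum => l _; rewrite normrZ mulrC; apply: ler_wpM2l; first exact: absr_ge0.
rewrite normrM normrX normfV normr_nat -/(ewt _ _).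
by apply: ewt_mono.
Unshelve. all: by end_near. Qed.

(** A total function of the sequence, so that linearity is an equality of elements
    of the function space. *)
Definition smooth_of c : Cinf K :=
  match pselect (entire c) with
  | left ec => MkCinf (smooth_pser co ec)
  | right _ => 0
  end.

Lemma smooth_ofE c : entire c -> smooth_of c = pser co c :> (R -> realified K).
Proof. by rewrite /smooth_of; case: pselect. Qed.

Lemma derivn_smooth_of c n : entire c ->
  Defs.derivn n (smooth_of c) = pser co (fun l => c (n + l)%N).
Proof. by move=> ec; rewrite /Defs.derivn smooth_ofE // derive1n_pser. Qed.

Lemma cinf_eq (f g : Cinf K) : (f =1 g :> (R -> realified K)) -> f = g.
Proof. by move=> fg; apply/val_inj/funext. Qed.

Lemma smooth_of_lin a c c' : entire c -> entire c' ->
  smooth_of (fun l => a * c l + c' l) = a *: smooth_of c + smooth_of c'.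
Proof.
move=> ec ec'; have ecc' := entire_lin a ec ec'; apply: cinf_eq => x.
rewrite smooth_ofE // pser_lin //.
by have := Defs.derivn_lin 0 a (smooth_of c) (smooth_of c') x; rewrite /Defs.derivn /= !smooth_ofE.
Qed.

Lemma smooth_of0 : smooth_of (fun=> 0) = 0.
Proof.
have := smooth_of_lin (-1) entire0 entire0.
rewrite (_ : (fun l => _) = (fun=> 0)); last by apply/funext => l; rewrite mulr0 addr0.
by rewrite scaleN1r addNr.
Qed.

Lemma smooth_of_sum n (a : 'I_n -> K) (cc : 'I_n -> nat -> K) :
  (forall i, entire (cc i)) ->
  entire (fun l => \sum_(i < n) a i * cc i l) /\
  smooth_of (fun l => \sum_(i < n) a i * cc i l) = \sum_(i < n) a i *: smooth_of (cc i).
Proof.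
elim: n a cc => [|n IHn] a cc ecc.
  rewrite (_ : (fun l => _) = (fun=> 0)).
    by rewrite smooth_of0 big_ord0; split => //; exact: entire0.
  by apply/funext => l; rewrite big_ord0.
rewrite (_ : (fun l => _) = (fun l => a ord_max * cc ord_max l +
   \sum_(i < n) a (widen_ord (leqnSn n) i) * cc (widen_ord (leqnSn n) i) l)); last first.
  by apply/funext => l; rewrite big_ord_recr /= addrC.
have [e1 e2] := IHn (fun i => a (widen_ord (leqnSn n) i))
  (fun i => cc (widen_ord (leqnSn n) i)) (fun i => ecc _).
split; first exact: entire_lin.
by rewrite smooth_of_lin // e2 big_ord_recr /= addrC.
Qed.

(** A derivative of order [l < k] costs [l!], and one unit of radius serves for
    all of them. *)
Lemma pk_smooth_of k c B : entire c -> nbnd c (k%:R + 1) B ->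
  pk k (smooth_of c) <= (\sum_(l < k) l`!%:R) * B.
Proof.
move=> ec cB; rewrite mulr_suml; apply: ler_sum => l _.
apply: sup_derivn_le => x; rewrite in_itv /= -ler_norml => xk.
rewrite derivn_smooth_of //; apply: norm_pser_le xk _; first exact: entire_shift.
exact: nbnd_shift.
Qed.

Lemma iter_deriv_smooth_of i c : entire c ->
  iter i (@deriv_op R K) (smooth_of c) = smooth_of (fun l => c (l + i)%N).
Proof.
move=> ec; apply: cinf_eq => x.
have E : iter i (@deriv_op R K) (smooth_of c) = Defs.derivn i (smooth_of c) :> (R -> realified K).
  by elim: i => [//|i IHi]; rewrite iterS /= IHi.
rewrite E derivn_smooth_of // (_ : (fun l => c (l + i)%N) = (fun l => c (i + l)%N)).
  by rewrite smooth_ofE //; exact: entire_shift.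
by apply/funext => l; rewrite addnC.
Qed.

Lemma polyD_smooth_of P c : entire c ->
  entire (Ts P c) /\ polyD P (smooth_of c) = smooth_of (Ts P c).
Proof.
move=> ec; have e i : entire (fun l => c (l + i)%N).
  rewrite (_ : (fun l => _) = (fun l => c (i + l)%N)); first exact: entire_shift.
  by apply/funext => l; rewrite addnC.
have [e1 e2] := @smooth_of_sum (size P) (fun i => P`_i) (fun i l => c (l + i)%N)
  (fun i => e i).
split=> //; rewrite /Ts e2; apply: eq_bigr => i _; by rewrite iter_deriv_smooth_of.
Qed.

Lemma iter_polyD_smooth_of P n c : entire c ->
  entire (Ts (P ^+ n) c) /\ iter n (polyD P) (smooth_of c) = smooth_of (Ts (P ^+ n) c).
Proof.
move=> ec; elim: n => [|n [IHe IHn]].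
  rewrite expr0 (_ : Ts 1 c = c) //; by apply/funext => l; rewrite Ts1.
have [e1 e2] := polyD_smooth_of P IHe.
have E : Ts (P ^+ n.+1) c = Ts P (Ts (P ^+ n) c).
  by apply/funext => l; rewrite exprS TsM.
by rewrite iterS IHn E.
Qed.

(** A polynomial as a sequence of exponential coefficients. *)
Definition pc b : nat -> K := fun l => b`_l.

Lemma nbnd_pc b r : 0 <= r -> nbnd (pc b) r (enorm r b).
Proof.
by move=> r0 L; apply: le_wnorm_partial => l; exact: ewt_ge0.
Qed.

Lemma entire_pc b : entire (pc b).
Proof. by move=> r r0; exists (enorm r b); exact: nbnd_pc. Qed.

Lemma pk_smooth_of_pc k b :
  pk k (smooth_of (pc b)) <= (\sum_(l < k) l`!%:R) * enorm (k%:R + 1) b.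
Proof.
by apply: pk_smooth_of; [exact: entire_pc|apply: nbnd_pc; rewrite addr_ge0].
Qed.

Lemma pser_pc b x L : (size b <= L)%N ->
  pser co (pc b) x = \sum_(l < L) (x ^+ l / l`!%:R) *: (b`_l : realified K).
Proof.
move=> bL; apply: realified_cvg_unique (@pser_cvg _ x (entire_pc b)) _.
apply: cvg_near_cst; exists L => // M /= LM.
rewrite (big_ord_widen M (fun l => (x ^+ l / l`!%:R) *: (b`_l : realified K)) LM).
rewrite [RHS]big_mkcond /=; apply: eq_bigr => l _.
case: ltnP => // Ll; rewrite /pc nth_default ?(leq_trans bL) //.
exact: scaler0.
Qed.

End entire_smooth.

(** * Coefficients of lacunary polynomials *)

Section lacunary.
Context {R : realType} {V : normedModType R}.

Lemma abel_sum (e : nat -> R) (al : nat -> V) L :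
  \sum_(j < L) e j *: al j =
  \sum_(j < L) (e j - e j.+1) *: (\sum_(i < j.+1) al i) + e L *: \sum_(i < L) al i.
Proof.
elim: L => [|L IHL]; first by rewrite !big_ord0 scaler0 addr0.
rewrite big_ord_recr /= IHL [in RHS]big_ord_recr /= -!addrA; congr (_ + _).
by rewrite -scalerDl subrK -scalerDr [in RHS]big_ord_recr.
Qed.

Lemma bernoulli_ge (t : R) n : 0 <= t <= 1 -> 1 - n%:R * t <= (1 - t) ^+ n.
Proof.
move=> /andP[t0 t1]; elim: n => [|n IHn]; first by rewrite mul0r subr0 expr0.
have h : 0 <= 1 - t by rewrite subr_ge0.
rewrite exprS (le_trans _ (ler_wpM2l h IHn)) //.
have n0 : 0 <= n%:R :> R by [].
have : 0 <= n%:R * (t * t) by rewrite !mulr_ge0.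
rewrite -natr1; lra.
Qed.

Lemma bernoulli_le (t : R) n : 0 <= t <= 1 -> (1 - t) ^+ n * (1 + n%:R * t) <= 1.
Proof.
move=> /andP[t0 t1]; have h : 0 <= 1 - t by rewrite subr_ge0.
elim: n => [|n IHn]; first by rewrite expr0 mul0r addr0 mulr1.
rewrite (le_trans _ IHn) // exprSr -mulrA ler_wpM2l ?exprn_ge0 //.
have n0 : 0 <= n%:R :> R by [].
have : 0 <= n%:R * (t * t) by rewrite !mulr_ge0.
have : 0 <= t * t by rewrite mulr_ge0.
rewrite -natr1; lra.
Qed.

(** At the point [1 - 1 / 8m] the monomials of exponent at most [m] are still
    close to 1, those of exponent at least [24 m] are already close to 0. *)
Lemma separating_point (m m' : nat) : (0 < m)%N -> (24 * m <= m')%N ->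
  exists2 x : R, 0 <= x <= 1 & 7%:R / 8%:R <= x ^+ m /\ x ^+ m' <= 1 / 8%:R.
Proof.
move=> m0 mm'; have mR : 1 <= m%:R :> R by rewrite ler1n.
pose t : R := (8%:R * m%:R)^-1.
have t0 : 0 < t by rewrite invr_gt0 mulr_gt0 // (lt_le_trans _ mR).
have mt : m%:R * t = 1 / 8%:R by rewrite /t; field; lra.
have t1 : t <= 1 by rewrite invf_le1 ?mulr_gt0 ?(lt_le_trans _ mR) //; lra.
have tt : 0 <= t <= 1 by rewrite t1 ltW.
have x0 : 0 <= 1 - t by rewrite subr_ge0.
have x1 : 1 - t <= 1 by rewrite gerBl ltW.
exists (1 - t); first by rewrite x0 x1.
split; first by have := bernoulli_ge m tt; rewrite mt; lra.
have h : (1 - t) ^+ (8 * m) <= 1 / 2%:R.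
  have := bernoulli_le (8 * m) tt; rewrite natrM -mulrA mt; lra.
have : (1 - t) ^+ m' <= (1 - t) ^+ (24 * m) by apply: ler_wiXn2l.
move=> /le_trans; apply; rewrite (_ : 24 * m = 8 * m * 3)%N; last by lia.
rewrite exprM; have := lerXn2r 3 _ _ h; rewrite !nnegrE exprn_ge0 //.
move=> /(_ erefl); rewrite divr_ge0 // => /(_ erefl) /le_trans; apply; lra.
Qed.

(** A rapidly lacunary family of monomials behaves on [0, 1] like the summing
    basis: the partial sums of the coefficients are almost values of the
    function, by Abel summation at the separating points. *)
Lemma lacunary_coef_bound (m : nat -> nat) (al : nat -> V) L (B : R) :
  (forall i, (0 < m i)%N) -> (forall i, (24 * m i <= m i.+1)%N) ->
  (forall x : R, 0 <= x <= 1 -> `|\sum_(i < L) x ^+ m i *: al i| <= B) ->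
  forall i, (i < L)%N -> `|al i| <= 4%:R * B.
Proof.
move=> m0 mS FB.
have B0 : 0 <= B by rewrite (le_trans _ (FB 0 _)) // lexx ler01.
pose S k := \sum_(i < k) al i.
pose A := `|S [arg max_(k > ord0 : 'I_L.+1) `|S k|]%O|.
have SA k : (k <= L)%N -> `|S k| <= A.
  move=> kL; rewrite /A; case: arg_maxP => //= j _ /(_ (inord k) isT).
  by rewrite inordK.
have SB k : (k <= L)%N -> `|S k| <= B + A / 2%:R.
  have A0 : 0 <= A by rewrite /A.
  case: k => [_|i iL]; first by rewrite /S big_ord0 normr0 addr_ge0 // divr_ge0.
  have [x x01 [xi xi1]] := separating_point (m0 i) (mS i).
  move/andP: (x01) => [x0 x1].
  (* With e vanishing at L, the boundary term of the summation by parts drops. *)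
  pose e j := if (j < L)%N then x ^+ m j else 0.
  pose d j := e j - e j.+1.
  have e0 j : 0 <= e j by rewrite /e; case: ifP => // _; rewrite exprn_ge0.
  have eS j : e j.+1 <= e j.
    rewrite /e; case: ltnP => [jL|_]; last by case: ifP => // _; rewrite exprn_ge0.
    rewrite (ltnW jL) ler_wiXn2l // (leq_trans _ (mS j)) // leq_pmull //.
  have d0 j : 0 <= d j by rewrite subr_ge0.
  have di : 3%:R / 4%:R <= d i.
    rewrite /d /e iL; case: ifP => _; last by rewrite subr0; lra.
    lra.
  have sd : \sum_(j < L) d j <= 1.
    have -> : \sum_(j < L) d j = e 0 - e L.
      elim: (L) => [|n IHn]; first by rewrite big_ord0 subrr.
      by rewrite big_ord_recr /= IHn /d; ring.
    rewrite lerBlDr (le_trans (_ : _ <= 1)) ?lerDl //.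
    by rewrite /e; case: ifP => // _; rewrite exprn_ile1.
  have F : \sum_(j < L) x ^+ m j *: al j = \sum_(j < L) d j *: S j.+1.
    have := abel_sum e al L; rewrite {4}/e ltnn scale0r addr0 => <-.
    by apply: eq_bigr => j _; rewrite /e ltn_ord.
  (* The weights d are nonnegative with sum at most 1, and d i is at least 3/4:
     the function at x is almost the single partial sum S i.+1. *)
  have {}F : S i.+1 = \sum_(j < L) x ^+ m j *: al j -
      \sum_(j < L) (d j - (j == i :> nat)%:R) *: S j.+1.
    rewrite F -sumrB (bigD1 (Ordinal iL)) //= eqxx big1 ?addr0.
      by rewrite -scalerBl opprB addrCA subrr addr0 scale1r.
    move=> j; rewrite -val_eqE /= => /negbTE ->.
    by rewrite subr0 subrr.
  rewrite F (le_trans (ler_normB _ _)) // lerD ?FB //.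
  rewrite (le_trans (ler_norm_sum _ _ _)) //.
  apply: (@le_trans _ _ (\sum_(j < L) `|d j - (j == i :> nat)%:R| * A)).
    by apply: ler_sum => j _; rewrite normrZ ler_wpM2l // SA.
  rewrite -mulr_suml mulrC ler_wpM2l //.
  rewrite (bigD1 (Ordinal iL)) //= eqxx.
  have d1 : d i <= 1.
    apply: le_trans sd; rewrite (bigD1 (Ordinal iL)) //= lerDl.
    by apply: sumr_ge0 => j _; exact: d0.
  rewrite ler0_norm ?subr_le0 //.
  have : \sum_(j < L | j != Ordinal iL) `|d j - (j == i :> nat)%:R| <= 1 - d i.
    rewrite lerBrDl (le_trans _ sd) // [leRHS](bigD1 (Ordinal iL)) //= lerD2l.
    apply: ler_sum => j; rewrite -val_eqE /= => /negbTE ->.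
    by rewrite subr0 ger0_norm.
  move=> sle; apply: le_trans (lerD (lexx _) sle) _.
  by rewrite (_ : true%:R = 1 :> R) //; lra.
have A2 : A <= 2%:R * B.
  have : A <= B + A / 2%:R by apply: SB; rewrite -ltnS.
  lra.
move=> i iL; have -> : al i = S i.+1 - S i.
  by rewrite /S big_ord_recr /= addrAC subrr add0r.
rewrite (le_trans (ler_normB _ _)) //.
have := SA _ iL; have := SA _ (ltnW iL); lra.
Qed.

End lacunary.

(** * Bernstein polynomials *)

Section bernstein.
Context {R : realType}.
Implicit Types (g h : nat -> R) (x a : R).

Fixpoint bernstein n g : {poly R} :=
  if n is n'.+1 then 'X * bernstein n' (fun i => g i.+1) + (1 - 'X) * bernstein n' g
  else (g 0)%:P.

Lemma bernsteinS n g x : (bernstein n.+1 g).[x] =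
  x * (bernstein n (fun i => g i.+1)).[x] + (1 - x) * (bernstein n g).[x].
Proof. by rewrite /= !hornerE. Qed.

Lemma bernstein_lin n a g h x : (bernstein n (fun i => a * g i + h i)).[x] =
  a * (bernstein n g).[x] + (bernstein n h).[x].
Proof.
elim: n g h => [|n IHn] g h; first by rewrite /= !hornerC.
by rewrite !bernsteinS !IHn; ring.
Qed.

Lemma bernstein_cst n a x : (bernstein n (fun=> a)).[x] = a.
Proof. by elim: n => [|n IHn]; rewrite ?hornerC // bernsteinS IHn; ring. Qed.

Lemma bernstein_le n g h x : 0 <= x <= 1 -> (forall i, (i <= n)%N -> g i <= h i) ->
  (bernstein n g).[x] <= (bernstein n h).[x].
Proof.
move=> /andP[x0 x1]; elim: n g h => [|n IHn] g h gh.
  by rewrite !hornerC gh.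
rewrite !bernsteinS lerD // ler_wpM2l ?subr_ge0 // IHn // => i i_n.
  exact: gh.
by rewrite gh // ltnW.
Qed.

Lemma bernstein_variance n a x :
  (bernstein n (fun i => (i%:R - a) ^+ 2)).[x] =
  (n%:R * x - a) ^+ 2 + n%:R * x * (1 - x).
Proof.
elim: n a => [|n IHn] a; first by rewrite hornerC; ring.
rewrite bernsteinS IHn.
have -> : (fun i => (i.+1%:R - a) ^+ 2) = (fun i => (i%:R - (a - 1)) ^+ 2) :> (nat -> R).
  by apply/funext => i; rewrite -natr1; congr (_ ^+ 2); ring.
rewrite IHn -natr1; ring.
Qed.

(** Quantitative Weierstrass theorem for Lipschitz functions: the Bernstein
    operator is positive, so its error is controlled by its action on
    [|i / n - x|], which is at most [d + (i / n - x)^2 / d]. *)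
Lemma bernstein_approx (f : R -> R) (M d : R) n x : (0 < n)%N -> 0 < d -> 0 <= M ->
  (forall s t, 0 <= s <= 1 -> 0 <= t <= 1 -> `|f s - f t| <= M * `|s - t|) ->
  0 <= x <= 1 ->
  `|(bernstein n (fun i => f (i%:R / n%:R))).[x] - f x| <= M * (d + 1 / (n%:R * d)).
Proof.
move=> n0 d0 M0 fM x01; have nR : 0 < n%:R :> R by rewrite ltr0n.
pose c := M / (d * n%:R ^+ 2); have c0 : 0 <= c.
  by rewrite divr_ge0 // mulr_ge0 ?exprn_ge0 // ltW.
pose err i := c * (i%:R - n%:R * x) ^+ 2 + M * d.
have fe i : (i <= n)%N -> `|f (i%:R / n%:R) - f x| <= err i.
  move=> i_n; have i01 : 0 <= (i%:R : R) / n%:R <= 1.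
    by rewrite divr_ge0 //= ler_pdivrMr // mul1r ler_nat.
  rewrite (le_trans (fM _ _ i01 x01)) //.
  have -> : err i = M * (d + `|i%:R / n%:R - x| ^+ 2 / d).
    rewrite /err /c real_normK ?num_real //; field; lra.
  rewrite ler_wpM2l //; set t := `|_|.
  have t0 : 0 <= t by rewrite /t.
  have [td|dt] := leP t d.
    by rewrite (le_trans td) // lerDl divr_ge0 ?exprn_ge0 // ltW.
  rewrite ler_wpDl ?(ltW d0) // expr2 -mulrA ler_peMr //.
  by rewrite ler_pdivlMr // mul1r ltW.
have E : (bernstein n err).[x] = c * (n%:R * x * (1 - x)) + M * d.
  by rewrite /err bernstein_lin bernstein_cst bernstein_variance subrr expr0n add0r.
have EB : (bernstein n err).[x] <= M * (d + 1 / (n%:R * d)).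
  move/andP: x01 => [x0 x1].
  rewrite E [leRHS]mulrDr [leLHS]addrC lerD2l.
  have -> : c * (n%:R * x * (1 - x)) = M / (n%:R * d) * (x * (1 - x)).
    by rewrite /c; field; lra.
  rewrite mul1r ler_piMr //; first by rewrite divr_ge0 // mulr_ge0 // ltW.
  have : 0 <= x * x by rewrite mulr_ge0.
  lra.
(* Positivity applies to f - f x and to its opposite. *)
have H s : s = 1 \/ s = -1 ->
    s * (bernstein n (fun i => f (i%:R / n%:R))).[x] - s * f x <= M * (d + 1 / (n%:R * d)).
  move=> s1; rewrite -(bernstein_cst n (- (s * f x)) x) -bernstein_lin.
  apply: le_trans EB; apply: bernstein_le => // i /fe.
  by rewrite ler_norml; case: s1 => ->; lra.
rewrite ler_norml; apply/andP; split.
  by have := H (-1) (or_intror erefl); lra.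
by have := H 1 (or_introl erefl); lra.
Qed.

End bernstein.

(** * Density of polynomials among smooth functions *)

Section smooth_approximation.
Context {R : realType}.
Implicit Types (q : {poly R}) (a e x y : R).

(** The mean value inequality. *)
Lemma lipschitz_of_derive (g g' : R -> R) a (M : R) :
  (forall x, is_derive x 1 g (g' x)) ->
  (forall x, `|x| <= a -> `|g' x| <= M) ->
  forall x y, `|x| <= a -> `|y| <= a -> `|g x - g y| <= M * `|x - y|.
Proof.
move=> dg gM.
have H x y : `|x| <= a -> `|y| <= a -> x < y -> `|g x - g y| <= M * `|x - y|.
  move=> xa ya xy.
  have cg : {within `[x, y], continuous g}.
    apply: continuous_subspaceT => z.
    by apply/differentiable_continuous/derivable1_diffP; have [] := dg z.
  have [c cxy gE] := MVT xy (fun z _ => dg z) cg.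
  rewrite distrC gE normrM [`|y - x|]distrC ler_wpM2r // gM //.
  move: cxy xa ya; rewrite in_itv /= !ler_norml => /andP[h1 h2] /andP[h3 h4] /andP[h5 h6].
  by apply/andP; split; lra.
move=> x y xa ya; have [xy|yx|->] := ltgtP x y.
- exact: H.
- by rewrite distrC [`|x - y|]distrC; exact: H.
- by rewrite !subrr normr0 mulr0.
Qed.

(** The affine substitution moves the Bernstein approximation from [0, 1] to
    [-a, a]; the derivative supplies the Lipschitz constant. *)
Lemma weierstrass (g : nat -> R -> R) a e : 0 < a -> 0 < e ->
  (forall l x, is_derive x 1 (g l) (g l.+1 x)) ->
  exists q, forall x, `|x| <= a -> `|g 0%N x - q.[x]| <= e.
Proof.
move=> a0 e0 dg.
have [M M0 gM] : exists2 M, 0 <= M & forall x, `|x| <= a -> `|g 1%N x| <= M.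
  have aa : - a <= a by rewrite ge0_cp // ltW.
  have cg : {within `[- a, a], continuous (fun x => `|g 1%N x|)}.
    apply: continuous_subspaceT => z; apply: continuous_comp.
      by apply/differentiable_continuous/derivable1_diffP; have [] := dg 1%N z.
    exact: norm_continuous.
  have [c _ gc] := EVT_max aa cg.
  by exists `|g 1%N c| => // x xa; apply: gc; rewrite in_itv /= -ler_norml.
pose f (t : R) := g 0%N (a * (2 * t - 1)).
pose L := M * (2 * a); have L0 : 0 <= L by rewrite !mulr_ge0 // ltW.
have fL (s t : R) : 0 <= s <= 1 -> 0 <= t <= 1 -> `|f s - f t| <= L * `|s - t|.
  have ia (u : R) : 0 <= u <= 1 -> `|a * (2 * u - 1)| <= a.
    move=> /andP[u0 u1]; rewrite normrM (gtr0_norm a0) ler_piMr ?(ltW a0) //.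
    by rewrite ler_norml; apply/andP; split; lra.
  move=> /ia s1 /ia t1.
  rewrite (le_trans (lipschitz_of_derive (dg 0%N) gM s1 t1)) // -mulrA ler_wpM2l //.
  have -> : a * (2 * s - 1) - a * (2 * t - 1) = 2 * a * (s - t) by ring.
  by rewrite normrM gtr0_norm // mulr_gt0.
pose d := e / (2 * (L + 1)).
have L1 : 0 < L + 1 by rewrite ltr_wpDl.
have d0 : 0 < d by rewrite divr_gt0 // mulr_gt0.
have [n nd] : exists n, (d ^+ 2)^-1 < n.+1%:R.
  exists (Num.truncn (d ^+ 2)^-1); exact: truncnS_gt.
pose q := bernstein n.+1 (fun i => f (i%:R / n.+1%:R)).
exists (q \Po ((2 * a)^-1 *: 'X + (2^-1)%:P)) => x xa.
pose t := (x / a + 1) / 2.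
have -> : (q \Po ((2 * a)^-1 *: 'X + (2^-1)%:P)).[x] = q.[t].
  by rewrite horner_comp; congr (horner q _); rewrite !hornerE /t; field; lra.
have -> : g 0%N x = f t by rewrite /f /t; congr (g 0%N _); field; lra.
have t01 : 0 <= t <= 1.
  move: xa; rewrite ler_norml => /andP[h1 h2].
  have h3 : x / a <= 1 by rewrite ler_pdivrMr // mul1r.
  have h4 : - 1 <= x / a by rewrite ler_pdivlMr // mulN1r.
  by rewrite /t; apply/andP; split; lra.
rewrite distrC (le_trans (bernstein_approx (ltn0Sn n) d0 L0 fL t01)) //.
have h : 1 / (n.+1%:R * d) <= d.
  have nd1 : 1 < n.+1%:R * d ^+ 2 by rewrite -ltr_pdivrMr ?exprn_gt0 // div1r.
  by rewrite ler_pdivrMr; [lra|rewrite mulr_gt0].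
have -> : e = (L + 1) * (d + d) by rewrite /d; field; lra.
by rewrite ler_pM ?lerDl ?lerD2l // addr_ge0 ?(ltW d0) // divr_ge0 // mulr_ge0 // ltW.
Qed.

Definition primitive q : {poly R} :=
  \poly_(i < (size q).+1) (q`_i.-1 / i%:R *+ (i != 0%N)).

Lemma deriv_primitive q : (primitive q)^`() = q.
Proof.
apply/polyP => i; rewrite coef_deriv coef_poly /= ltnS mulr1n.
case: ltnP => [_|qi]; last by rewrite mul0rn nth_default.
by rewrite -[LHS]mulr_natr divfK // pnatr_eq0.
Qed.

Lemma primitive0 q : (primitive q).[0] = 0.
Proof. by rewrite horner_coef0 coef_poly. Qed.

(** Approximating the derivative of highest order and integrating back
    approximates all lower derivatives. *)
Lemma poly_approx k (g : nat -> R -> R) a e : 0 < a -> 0 < e ->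
  (forall l x, is_derive x 1 (g l) (g l.+1 x)) ->
  exists q, forall l x, (l <= k)%N -> `|x| <= a ->
    `|g l x - (q^`(l)).[x]| <= e.
Proof.
elim: k g e => [|k IHk] g e a0 e0 dg.
  have [q qP] := weierstrass a0 e0 dg.
  by exists q => l x; rewrite leqn0 => /eqP ->; exact: qP.
have a1 : 0 < a + 1 by rewrite ltr_wpDl // ltW.
have [q' q'P] := IHk (fun l => g l.+1) (e / (a + 1)) a0 (divr_gt0 e0 a1)
  (fun l x => dg l.+1 x).
pose q := primitive q' + (g 0%N 0)%:P.
have dq : q^`() = q' by rewrite derivD deriv_primitive derivC addr0.
exists q => -[|l] x lk xa; last first.
  rewrite derivSn dq (le_trans (q'P _ _ _ _)) // ler_pdivrMr // ler_peMr ?(ltW e0) //.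
  by rewrite lerDr ltW.
rewrite derivn0.
have dgq (y : R) : is_derive y 1 (fun z => g 0%N z - q.[z]) (g 1%N y - q'.[y]).
  apply: is_deriveB; apply: DeriveDef; first exact: derivable_horner.
  by rewrite -derive1E -derivE dq.
have gM (y : R) : `|y| <= a -> `|g 1%N y - q'.[y]| <= e / (a + 1).
  by move=> ya; have := q'P 0%N y isT ya; rewrite derivn0.
have a00 : `|0 : R| <= a by rewrite normr0 ltW.
have := lipschitz_of_derive dgq gM xa a00.
have -> : g 0%N 0 - q.[0] = 0.
  by rewrite hornerD primitive0 hornerC add0r subrr.
rewrite !subr0 => /le_trans; apply.
rewrite mulrAC ler_pdivrMr // ler_wpM2l ?(ltW e0) //.
by rewrite (le_trans xa) // lerDl.
Qed.

End smooth_approximation.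

Section real_coordinate.
Context {R : realType} {K : scalars R} (phi : K -> R).
Hypothesis phi_lin :
  forall s z w, phi (of_real K s * z + w) = s * phi z + phi w.
Hypothesis phi_le : forall z, `|phi z| <= absr z.

Lemma phi0 : phi 0 = 0.
Proof. by apply/normr0_eq0/le_anti; rewrite normr_ge0 andbT -[leRHS](@absr0 _ K). Qed.

Lemma phiB z w : phi (z - w) = phi z - phi w.
Proof.
have := phi_lin (-1) w z; rewrite rmorphN rmorph1 !mulN1r.
by rewrite addrC => ->; rewrite addrC.
Qed.

Lemma phiZ s z : phi (of_real K s * z) = s * phi z.
Proof. by have := phi_lin s z 0; rewrite addr0 phi0 addr0. Qed.

(** Domination by the absolute value and additivity give continuity. *)
Lemma phi_continuous (z : realified K) : phi y @[y --> z] --> phi z.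
Proof.
apply/(@cvgrPdist_lt _ _ _ (nbhs z)) => e e0; near=> y; rewrite -phiB (le_lt_trans (phi_le _)) //.
by near: y; apply: cvgr_dist_lt.
Unshelve. all: by end_near. Qed.

Lemma is_derive_coordinate (F : R -> realified K) x : derivable F x 1 ->
  is_derive x 1 (fun y => phi (F y)) (phi (derive1 F x)).
Proof.
move=> dF.
have H : (fun h : R => h^-1 *: (((fun y => phi (F y)) \o shift x) (h *: 1) - phi (F x)))
    @ 0^' --> phi (derive1 F x).
  rewrite (_ : (fun h => _) = (phi : realified K -> R) \o
     (fun h : R => h^-1 *: ((F \o shift x) (h *: 1) - F x))); last first.
    by apply/funext => h /=; rewrite realified_scaleE phiZ phiB.
  by apply: cvg_comp (@phi_continuous _); rewrite derive1E; exact: dF.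
apply: DeriveDef; first by apply/cvg_ex; exists (phi (derive1 F x)).
exact: cvg_lim.
Qed.

End real_coordinate.

Section density.
Context {R : realType} {K : scalars R} (co : coordinates K).
Implicit Types (q : {poly R}) (b : {poly K}).

(** The exponential coefficients of an ordinary real polynomial. *)
Definition expcoef q : {poly K} := \poly_(l < size q) of_real K (q`_l * l`!%:R).

Lemma coef_expcoef q l : (expcoef q)`_l = of_real K (q`_l * l`!%:R).
Proof.
rewrite coef_poly; case: ltnP => // ql.
by rewrite nth_default // mul0r rmorph0.
Qed.

Lemma smooth_of_expcoef q l x :
  Defs.derivn l (smooth_of co (pc (expcoef q))) x = of_real K (q^`(l)).[x].
Proof.
rewrite derivn_smooth_of; last exact: entire_pc.
have -> : (fun i => pc (expcoef q) (l + i)) = pc (expcoef q^`(l)) :> (nat -> K).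
  apply/funext => i; rewrite /pc !coef_expcoef coef_derivn; congr (of_real K _).
  have E : ((l + i) ^_ l * i`! = (l + i)`!)%N.
    by rewrite -(@ffact_fact (l + i) l) ?leq_addr // addKn.
  by rewrite -E natrM mulrA [q`_(l + i) * _]mulr_natr.
rewrite (@pser_pc _ _ co (expcoef q^`(l)) x (size q^`(l))) ?size_poly //.
rewrite horner_coef rmorph_sum; apply: eq_bigr => i _ /=.
rewrite realified_scaleE coef_expcoef -rmorphM; congr (of_real K _).
by have := fact_gt0R (R := R) i => /lt0r_neq0 ?; field.
Qed.

(** A countable family of polynomials, hence possible targets for an induction
    over the natural numbers. *)
Definition ratpoly (s : seq (rat * rat)) : {poly K} :=
  \poly_(l < size s) (of_real K (ratr (nth (0, 0) s l).1) +
                      of_real K (ratr (nth (0, 0) s l).2) * im_unit co).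

Lemma ratpoly_dense b (r e : R) : 0 <= r -> 0 < e ->
  exists s, enorm r (ratpoly s - b) <= e.
Proof.
move=> r0 e0; pose jn := absr (im_unit co).
have jn0 : 0 <= jn by exact: absr_ge0.
have er0 : 0 < expR r by exact: expR_gt0.
pose d := e / (expR r * (1 + jn)).
have J0 : 0 < expR r * (1 + jn) by rewrite mulr_gt0 // ltr_pwDl.
have d0 : 0 < d by rewrite divr_gt0.
have rat_near (y : R) : exists t : rat, `|ratr t - y| <= d.
  have yy : y - d < y + d by lra.
  have [t] := rat_in_itvoo yy; rewrite in_itv /= => /andP[h1 h2].
  by exists t; rewrite ler_norml; apply/andP; split; lra.
pose near_re (y : R) := projT1 (cid (rat_near y)).
have near_reP y : `|ratr (near_re y) - y| <= d := projT2 (cid (rat_near y)).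
pose s := [seq (near_re (re_part co z), near_re (im_part co z)) | z <- b : seq K].
exists s; rewrite /enorm (@wnorm_widen _ _ _ (size b)); last first.
  by rewrite (leq_trans (size_polyD _ _)) // size_polyN geq_max leqnn andbT
    (leq_trans (size_poly _ _)) // size_map.
apply: (@le_trans _ _ (\sum_(l < size b) (d * (1 + jn)) * ewt r l)).
  apply: ler_sum => l _; rewrite ler_wpM2r ?ewt_ge0 //.
  rewrite coefB coef_poly size_map ltn_ord (nth_map 0) //= {3}(coordE co b`_l).
  rewrite opprD addrACA -mulrBl -!rmorphB (le_trans (absrD _ _)) //.
  rewrite absrM !absr_of_real mulrDr mulr1 lerD // ler_wpM2r //.
rewrite -mulr_sumr (le_trans (ler_wpM2l _ (sum_ewt_le _ r0))) //.
  by rewrite mulr_ge0 ?(ltW d0) // addr_ge0.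
by rewrite /d le_eqVlt; apply/orP; left; apply/eqP; field; lra.
Qed.

Lemma poly_dense (f : Cinf K) k e : 0 < e ->
  exists b, pk k (smooth_of co (pc b) - f) <= e.
Proof.
move=> e0; pose jn := absr (im_unit co).
have jn0 : 0 <= jn by exact: absr_ge0.
pose d := e / (k.+1%:R * (1 + jn)).
have J0 : 0 < k.+1%:R * (1 + jn) by rewrite mulr_gt0 // ltr_pwDl.
have d0 : 0 < d by rewrite divr_gt0.
have dre (l : nat) (x : R) : is_derive x 1 (fun y => re_part co (Defs.derivn l f y))
    (re_part co (Defs.derivn l.+1 f x)).
  by apply: is_derive_coordinate (re_lin co) (re_le co) _ _ _; exact: derivable_derivn.
have [q1 q1P] := @poly_approx _ k (fun l x => re_part co (Defs.derivn l f x))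
  k.+1%:R d (ltr0Sn _ _) d0 dre.
have dim (l : nat) (x : R) : is_derive x 1 (fun y => im_part co (Defs.derivn l f y))
    (im_part co (Defs.derivn l.+1 f x)).
  by apply: is_derive_coordinate (im_lin co) (im_le co) _ _ _; exact: derivable_derivn.
have [q2 q2P] := @poly_approx _ k (fun l x => im_part co (Defs.derivn l f x))
  k.+1%:R d (ltr0Sn _ _) d0 dim.
exists (im_unit co *: expcoef q2 + expcoef q1).
have -> : smooth_of co (pc (im_unit co *: expcoef q2 + expcoef q1)) =
    im_unit co *: smooth_of co (pc (expcoef q2)) + smooth_of co (pc (expcoef q1)).
  rewrite -smooth_of_lin; [|exact: entire_pc|exact: entire_pc].
  by congr (smooth_of co _); apply/funext => l; rewrite /pc coefD coefZ.
apply: (@le_trans _ _ (\sum_(l < k) (d * (1 + jn)))); last first.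
  rewrite sumr_const card_ord -mulr_natl.
  have -> : e = k.+1%:R * (d * (1 + jn)) by rewrite mulrCA divfK ?lt0r_neq0.
  rewrite ler_wpM2r ?ler_nat // mulr_ge0 ?(ltW d0) // addr_ge0 //.
apply: ler_sum => l _; apply: sup_derivn_le => x; rewrite in_itv /= -ler_norml => xk.
have xk1 : `|x| <= k.+1%:R by rewrite (le_trans xk) // ler_nat.
rewrite -scaleN1r addrC Defs.derivn_lin Defs.derivn_lin !smooth_of_expcoef mulN1r.
have := q1P l x (ltnW (ltn_ord l)) xk1; have := q2P l x (ltnW (ltn_ord l)) xk1.
set z := Defs.derivn l f x => h2 h1.
rewrite {1}(coordE co z).
have -> : - (of_real K (re_part co z) + of_real K (im_part co z) * im_unit co) +
   (im_unit co * of_real K (q2^`(l)).[x] + of_real K (q1^`(l)).[x]) =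
   - of_real K (re_part co z - (q1^`(l)).[x]) -
   of_real K (im_part co z - (q2^`(l)).[x]) * im_unit co :> K.
  by rewrite !rmorphB /=; ring.
rewrite [leLHS]/(absr _) (le_trans (absrD _ _)) // !absrN absrM !absr_of_real.
by rewrite mulrDr mulr1 lerD // ler_wpM2r.
Qed.

(** Coefficients may be perturbed, because [enorm] controls [pk k]. *)
Lemma ratpoly_smooth_of_dense (f : Cinf K) k e : 0 < e ->
  exists s, pk k (smooth_of co (pc (ratpoly s)) - f) <= e.
Proof.
move=> e0; have e2 : 0 < e / 2 by rewrite divr_gt0.
have [b bf] := poly_dense f k e2.
pose C : R := \sum_(l < k) l`!%:R.
have C0 : 0 <= C by apply: sumr_ge0.
have C1 : 0 < C + 1 by rewrite ltr_wpDl.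
have k1 : 0 <= k%:R + 1 :> R by rewrite addr_ge0.
have [s sb] := ratpoly_dense b k1 (divr_gt0 e2 C1).
exists s; rewrite -(subrKA (smooth_of co (pc b))) (le_trans (pkD _ _ _)) //.
rewrite (splitr e) lerD //.
have -> : smooth_of co (pc (ratpoly s)) - smooth_of co (pc b) = smooth_of co (pc (ratpoly s - b)).
  rewrite addrC -scaleN1r -smooth_of_lin; [|exact: entire_pc|exact: entire_pc].
  by congr (smooth_of co _); apply/funext => l; rewrite /pc coefB mulN1r addrC.
rewrite (le_trans (pk_smooth_of_pc _ _ _)) // -/C.
rewrite (le_trans (ler_wpM2l C0 sb)) // mulrC -mulrA ler_piMr ?(ltW e2) //.
by rewrite mulrC ler_pdivrMr // mul1r lerDl.
Qed.

End density.

(** * The inductive construction *)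

Section dependent_choice.

(** Dependent choice in which each term may depend on all the previous ones,
    read off from the list of these. *)
Lemma history_choice (S : Type) (x0 : S) (Q : nat -> (nat -> S) -> S -> Prop) :
  (forall n g, exists x, Q n g x) ->
  exists f : nat -> S, forall n, Q n (nth x0 (mkseq f n)) (f n).
Proof.
move=> ex; pose next n g := projT1 (cid (ex n g)).
pose h := fix h n := if n is n'.+1 then rcons (h n') (next n' (nth x0 (h n'))) else [::].
pose f n := next n (nth x0 (h n)); exists f => n.
have -> : mkseq f n = h n; last exact: projT2 (cid (ex n (nth x0 (h n)))).
by elim: n => [//|n IHn]; rewrite mkseqS IHn.
Qed.

End dependent_choice.

Section construction.
Context {R : realType} {K : scalars R}.
Variables (P : {poly K}) (j : nat -> nat) (w : nat -> {poly K}).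

(** The exponential coefficients of the function [x ^ m]. *)
Definition mono m : {poly K} := m`!%:R *: 'X^m.

Lemma coef_mono m l : (mono m)`_l = m`!%:R *+ (l == m).
Proof. by rewrite coefZ coefXn mulr_natr. Qed.

Lemma enorm_mono (r : R) m : enorm r (mono m) = r ^+ m.
Proof.
by rewrite /enorm wnormZ wnorm_Xn absr_nat /ewt mulrCA mulfV ?mulr1.
Qed.

(** The error allowed at stage [s].  These errors add up to 1/8, small enough
    to be absorbed in [coef_bound1]. *)
Definition theta s : R := 2^-1 ^+ s / 16%:R.

Lemma theta_gt0 s : 0 < theta s.
Proof. by rewrite divr_gt0 // exprn_gt0. Qed.

(** The basic vectors are [x ^ mexp i] perturbed by the [ucor s i]; the power
    [npow s] of the operator sends the perturbed vector of index [j s] close to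
    the target [w s] and the other ones of index at most [s] close to 0.
    Smallness at stage [s] is measured at radius [s + 2], so that already the
    first stage is controlled at radius 2, the one that governs [pk 1]. *)
Record construction := Construction {
  mexp : nat -> nat;
  npow : nat -> nat;
  ucor : nat -> nat -> {poly K};
  M_gt0 : forall s, (0 < mexp s)%N;
  M_ge : forall s, (s <= mexp s)%N;
  M_lacunary : forall s, (24 * mexp s <= mexp s.+1)%N;
  U_size : forall t s i, (t < s)%N -> (size (ucor t i) <= mexp s)%N;
  U_low : forall s i l, (l <= mexp s)%N -> (ucor s i)`_l = 0;
  U_triangular : forall s i, (s < i)%N -> ucor s i = 0;
  U_small : forall s, \sum_(i < s.+1) enorm s.+2%:R (ucor s i) <= theta s;
  Tcost_le : forall t s, (t < s)%N -> Tcost (P ^+ npow t) <= 2 ^+ mexp s;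
  TU_small : forall t s, (t < s)%N ->
    \sum_(i < s.+1) Tcost (P ^+ npow t) * enorm s.+2%:R (ucor s i) <= theta s;
  target : forall s, \sum_(i < s.+1) enorm s%:R
    (Tp (P ^+ npow s) (mono (mexp i) + \sum_(t < s.+1) ucor t i) -
       (i == j s :> nat)%:R *: w s) <= theta s
}.

Let stage := (nat * nat * (nat -> {poly K}))%type.
Let stage0 : stage := (0%N, 0%N, fun=> 0).
Let sM (x : stage) := x.1.1.
Let sN (x : stage) := x.1.2.
Let sU (x : stage) := x.2.

Let good n (g : nat -> stage) (x : stage) :=
  [/\ (0 < sM x)%N /\ (n <= sM x)%N,
   forall t, (t < n)%N -> [/\ (24 * sM (g t) <= sM x)%N,
     forall i, (i < t.+1)%N -> (size (sU (g t) i) <= sM x)%N &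
     Tcost (P ^+ sN (g t)) <= 2 ^+ sM x],
   (forall i l, (l <= sM x)%N -> (sU x i)`_l = 0) /\
   (forall i, (n < i)%N -> sU x i = 0),
   forall i, (i < n.+1)%N -> enorm n.+2%:R (sU x i) <= theta n / n.+1%:R /\
     forall t, (t < n)%N ->
      Tcost (P ^+ sN (g t)) * enorm n.+2%:R (sU x i) <= theta n / n.+1%:R &
   forall i, (i < n.+1)%N ->
     enorm n%:R (Tp (P ^+ sN x) (mono (if (i < n)%N then sM (g i) else sM x) +
        (\sum_(t < n) sU (g t) i + sU x i)) - (i == j n)%:R *: w n)
       <= theta n / n.+1%:R].

Lemma exists_pow2_ge (c : R) : exists m, forall m', (m <= m')%N -> c <= 2 ^+ m'.
Proof.
exists (Num.truncn c).+1 => m' mm'; rewrite (le_trans (ltW (truncnS_gt c))) //.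
rewrite (@le_trans _ _ (2 ^+ (Num.truncn c).+1)) //.
  by rewrite -natrX ler_nat ltnW // ltn_expl.
by rewrite ler_eXn2l // ltr1n.
Qed.

(** The maximum of the thresholds serves for all the conditions at once. *)
Lemma common_bound (Q : nat -> nat -> Prop) n :
  (forall t, (t < n)%N -> exists m, forall m', (m <= m')%N -> Q t m') ->
  exists m, forall m', (m <= m')%N -> forall t, (t < n)%N -> Q t m'.
Proof.
elim: n => [|n IHn] H; first by exists 0%N.
have [m mP] := IHn (fun t tn => H t (ltnW tn)).
have [m1 m1P] := H n (ltnSn n).
exists (maxn m m1) => m'; rewrite geq_max => /andP[mm' m1m'] t.
by rewrite ltnS leq_eqVlt => /orP[/eqP ->|tn]; [exact: m1P|exact: mP].
Qed.

(** At each stage the exponent is chosen first, beyond everything that came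
    before.  The perturbations and the power follow from [small_solution], for
    an error divided by the costs of the earlier powers. *)
Lemma good_exists : (1 < size P)%N -> forall n g, exists x, good n g x.
Proof.
move=> sP n g.
have [m mP] : exists m, forall m', (m <= m')%N -> forall t, (t < n)%N ->
    [/\ (24 * sM (g t) <= m')%N,
     forall i, (i < t.+1)%N -> (size (sU (g t) i) <= m')%N &
     Tcost (P ^+ sN (g t)) <= 2 ^+ m'].
  apply: common_bound => t _.
  have [m1 m1P] := @exists_pow2_ge (Tcost (P ^+ sN (g t))).
  have [m2 m2P] : exists m, forall m', (m <= m')%N -> forall i, (i < t.+1)%N ->
      (size (sU (g t) i) <= m')%N.
    by apply: common_bound => i _; exists (size (sU (g t) i)).
  exists (maxn (24 * sM (g t)) (maxn m1 m2)) => m'.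
  rewrite !geq_max => /and3P[h1 h2 h3]; split => //.
    exact: m2P.
  exact: m1P.
pose m0 := maxn 1 (maxn n m).
have m01 : (0 < m0)%N by rewrite leq_max.
have m0n : (n <= m0)%N by rewrite !leq_max leqnn orbT.
have m0m : (m <= m0)%N by rewrite !leq_max leqnn !orbT.
pose C := 1 + \sum_(t < n) Tcost (P ^+ sN (g t)).
have Ct t : (t < n)%N -> Tcost (P ^+ sN (g t)) <= C.
  move=> tn; rewrite /C (bigD1 (Ordinal tn)) //= addrCA lerDl addr_ge0 //.
  by apply: sumr_ge0 => i _; exact: Tcost_ge0.
have C1 : 1 <= C by rewrite lerDl sumr_ge0 // => i _; exact: Tcost_ge0.
have C0 : 0 < C by rewrite (lt_le_trans _ C1).
pose e := theta n / n.+1%:R.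
have e0 : 0 < e by rewrite divr_gt0 // theta_gt0.
have eC0 : 0 < e / C by rewrite divr_gt0.
pose f i := mono (if (i < n)%N then sM (g i) else m0) + \sum_(t < n) sU (g t) i.
have [n1 n1P] : exists n1, forall n', (n1 <= n')%N -> forall i, (i < n.+1)%N ->
   exists u : {poly K}, [/\ forall l, (l < n')%N -> u`_l = 0,
     enorm n.+2%:R u <= e / C &
     enorm n.+2%:R (Tp (P ^+ n') (f i + u) - (i == j n)%:R *: w n) <= e / C].
  by apply: common_bound => i _; exact: small_solution.
pose n0 := maxn n1 m0.+1.
have /choice[u uP] : forall i, exists u : {poly K},
   (if (i < n.+1)%N then [/\ forall l, (l < n0)%N -> u`_l = 0,
     enorm n.+2%:R u <= e / C &
     enorm n.+2%:R (Tp (P ^+ n0) (f i + u) - (i == j n)%:R *: w n) <= e / C]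
    else u = 0).
  move=> i; case: ltnP => [i_n|_]; last by exists 0.
  by apply: n1P => //; rewrite leq_maxl.
have eCe : e / C <= e by rewrite ler_pdivrMr // ler_peMr // ltW.
exists (m0, n0, u); split => //=.
- by move=> t tn; exact: mP.
- split=> [i l lm|i ni]; have := uP i; last by rewrite ltnS leqNgt ni.
  case: ifP => [_ [-> //]|_ ->]; last by rewrite coef0.
  by rewrite leq_max ltnS lm orbT.
- move=> i i_n; have := uP i; rewrite i_n => -[_ h1 _].
  split=> [|t tn]; first exact: le_trans h1 eCe.
  have -> : theta n / n.+1%:R = C * (e / C) by rewrite [RHS]mulrC divfK // lt0r_neq0.
  by apply: ler_pM (Ct _ tn) h1; rewrite ?Tcost_ge0 // enorm_ge0.
- move=> i i_n; have := uP i; rewrite i_n => -[_ _ h2].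
  rewrite addrA; apply: le_trans (le_trans h2 eCe); apply: enorm_le_radius => //.
  by rewrite ler_nat ltnW.
Qed.

Lemma construction_exists : (1 < size P)%N -> inhabited construction.
Proof.
move=> sP; have [f fP] := history_choice stage0 (good_exists sP).
have E n t : (t < n)%N -> nth stage0 (mkseq f n) t = f t by move=> tn; rewrite nth_mkseq.
have sum_const s (F : 'I_s.+1 -> R) : (forall i, F i <= theta s / s.+1%:R) ->
    \sum_(i < s.+1) F i <= theta s.
  move=> FP; rewrite (le_trans (ler_sum _ (fun i _ => FP i))) //.
  by rewrite sumr_const card_ord -[leLHS]mulr_natl [leLHS]mulrC divfK // pnatr_eq0.
have past s t : (t < s)%N -> [/\ (24 * sM (f t) <= sM (f s))%N,
     forall i, (i < t.+1)%N -> (size (sU (f t) i) <= sM (f s))%N &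
     Tcost (P ^+ sN (f t)) <= 2 ^+ sM (f s)].
  by move=> ts; have [_ h _ _ _] := fP s; have := h t ts; rewrite E.
have tri s i : (s < i)%N -> sU (f s) i = 0 by have [_ _ [_ h] _ _] := fP s; exact: h.
constructor; apply: (@Construction (fun s => sM (f s)) (fun s => sN (f s))
  (fun s => sU (f s))).
- by move=> s; have [[h _] _ _ _ _] := fP s.
- by move=> s; have [[_ h] _ _ _ _] := fP s.
- by move=> s; have [] := past _ _ (ltnSn s).
- move=> t s i ts; have [_ h _] := past _ _ ts.
  by have [it|ti] := leqP i t; [exact: h|rewrite tri // size_poly0].
- by move=> s i l; have [_ _ [h _] _ _] := fP s; exact: h.
- exact: tri.
- by move=> s; apply: sum_const => i; have [_ _ _ h _] := fP s; have [] := h i (ltn_ord i).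
- by move=> t s ts; have [] := past _ _ ts.
- move=> t s ts; apply: sum_const => i.
  have [_ _ _ h _] := fP s; have [_ h'] := h i (ltn_ord i).
  by have := h' t ts; rewrite E.
- move=> s; apply: sum_const => i; have [_ _ _ _ h] := fP s; move: (h i (ltn_ord i)).
  rewrite big_ord_recr /=.
  have -> : \sum_(t < s) sU (nth stage0 (mkseq f s) t) i = \sum_(t < s) sU (f t) i.
    by apply: eq_bigr => t _; rewrite E.
  have -> // : (if (i < s)%N then sM (nth stage0 (mkseq f s) i) else sM (f s)) = sM (f i).
  case: ltnP => [/E -> //|si]; congr (sM (f _)).
  by apply/eqP; rewrite eqn_leq si -ltnS ltn_ord.
Qed.

End construction.

(** * Combinations of the constructed vectors *)

Section construction_bounds.
Context {R : realType} {K : scalars R} {P : {poly K}} {j : nat -> nat}.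
Context {w : nat -> {poly K}} (D : construction P j w).
Implicit Types (a b : nat -> K) (r A B : R).

Local Notation M := (mexp D).
Local Notation N := (npow D).
Local Notation U := (ucor D).

Definition block a s : {poly K} := a s *: mono (M s) + \sum_(i < s.+1) a i *: U s i.

Definition partial a L : {poly K} := \sum_(s < L) block a s.

(** The coefficients of [sum_s block a s]: only finitely many blocks
    contribute to each of them. *)
Definition coefs a : nat -> K := fun l => \sum_(s < l.+1) (block a s)`_l.

Lemma block_low a s l : (l < s)%N -> (block a s)`_l = 0.
Proof.
move=> ls; have lM : (l < M s)%N by rewrite (leq_trans ls) // M_ge.
rewrite coefD coefZ coef_mono ltn_eqF // mulr0 add0r coef_sum big1 // => i _.
by rewrite coefZ U_low ?mulr0 // ltnW.
Qed.

Lemma coefs_partial a L l : (l < L)%N -> coefs a l = (partial a L)`_l.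
Proof.
move=> lL; rewrite coef_sum /coefs.
rewrite (big_ord_widen _ (fun s => (block a s)`_l) lL).
rewrite [RHS](bigID (fun s : 'I_L => (s < l.+1)%N)) /= [X in _ = _ + X]big1 ?addr0 //.
by move=> s; rewrite -leqNgt => ls; rewrite block_low.
Qed.

Lemma coefs_lin c a b l : coefs (fun i => c * a i + b i) l = c * coefs a l + coefs b l.
Proof.
rewrite /coefs mulr_sumr -big_split; apply: eq_bigr => s _ /=.
rewrite /block -!coefZ -coefD; congr (_`_l).
have -> : \sum_(i < s.+1) (c * a i + b i) *: U s i =
    c *: (\sum_(i < s.+1) a i *: U s i) + \sum_(i < s.+1) b i *: U s i.
  rewrite scaler_sumr -big_split; apply: eq_bigr => i _ /=.
  by rewrite scalerDl scalerA.
by rewrite scalerDl -scalerA addrACA -scalerDr.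
Qed.

(** Finitely many coefficients involve finitely many blocks, even after applying
    a differential operator, so bounds on the polynomials pass to the limit. *)
Lemma nbnd_of_partial Q a (v : {poly K}) r B L0 : 0 <= r ->
  (forall L, (L0 <= L)%N -> enorm r (Tp Q (partial a L) - v) <= B) ->
  nbnd (fun l => Ts Q (coefs a) l - v`_l) r B.
Proof.
move=> r0 H L; pose L1 := maxn L0 (L + size Q).
rewrite (le_trans _ (H L1 _)) ?leq_maxl //.
rewrite (le_trans _ (le_wnorm_partial (fun l => ewt_ge0 l r0) L _)) //.
apply: ler_sum => l _; rewrite coefB coef_Tp.
rewrite (@Ts_eq _ _ Q (coefs a) (fun l => (partial a L1)`_l) l L1) //.
  by move=> i; exact: coefs_partial.
by rewrite (leq_trans _ (leq_maxr _ _)) // leq_add2r ltnW.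
Qed.

Lemma M_homo s t : (s < t)%N -> (M s < M t)%N.
Proof.
elim: t => [//|t IHt]; rewrite ltnS leq_eqVlt => h.
have h' : (M t < M t.+1)%N.
  by apply: leq_trans (M_lacunary D t); have := M_gt0 D t; lia.
by case/orP: h => [/eqP ->|/IHt h1] //; exact: ltn_trans h1 h'.
Qed.

(** The exponents avoid the degrees of all perturbations: those of earlier stages
    have smaller degree, the others start in higher degree.  So the [a i] can be
    read off from the derivatives of the function at the origin. *)
Lemma coefs_M a i : coefs a (M i) = (M i)`!%:R * a i.
Proof.
have iM : (i < (M i).+1)%N by rewrite ltnS M_ge.
rewrite /coefs (bigD1 (Ordinal iM)) //= big1 ?addr0.
  rewrite coefD coefZ coef_mono eqxx mulrC coef_sum big1 ?addr0 // => k _.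
  by rewrite coefZ U_low // mulr0.
move=> s; rewrite -val_eqE /= => si.
rewrite coefD coefZ coef_mono coef_sum.
have [lt|gt|E] := ltngtP s i; last by rewrite E eqxx in si.
  rewrite gtn_eqF ?M_homo // mulr0 add0r big1 // => k _.
  by rewrite coefZ nth_default ?mulr0 // U_size.
rewrite ltn_eqF ?M_homo // mulr0 add0r big1 // => k _.
by rewrite coefZ U_low ?mulr0 // ltnW // M_homo.
Qed.

Lemma expr_half_sum (B : R) n m : 0 <= B ->
  \sum_(n <= s < m) B * 2^-1 ^+ s <= 2 * B * 2^-1 ^+ n.
Proof.
move=> B0; have [nm|mn] := leqP n m; last first.
  by rewrite big_geq ?(ltnW mn) // !mulr_ge0 ?exprn_ge0.
suff -> : \sum_(n <= s < m) B * 2^-1 ^+ s = 2 * B * (2^-1 ^+ n - 2^-1 ^+ m).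
  by rewrite ler_wpM2l ?mulr_ge0 // gerBl exprn_ge0.
elim: m nm => [|m IHm]; first by rewrite leqn0 => /eqP ->; rewrite big_geq // subrr mulr0.
rewrite leq_eqVlt => /orP[/eqP <-|nm]; first by rewrite big_geq // subrr mulr0.
by rewrite big_nat_recr //= IHm // exprSr; field.
Qed.

Lemma theta_sum n m : \sum_(n <= s < m) (theta s : R) <= 2 * theta n.
Proof.
have := @expr_half_sum (16%:R^-1) n m; rewrite invr_ge0 => /(_ (ler0n _ _)).
rewrite /theta; under eq_bigr do rewrite mulrC.
by move=> /le_trans; apply; rewrite -mulrA [X in 2 * X]mulrC.
Qed.

(** The stages below [r] are finitely many; at the later ones [U_small] applies. *)
Lemma U_bound r : 0 <= r -> exists2 E, 0 <= E &
  forall L, \sum_(s < L) \sum_(i < s.+1) enorm r (U s i) <= E.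
Proof.
move=> r0; pose S0 := (Num.truncn r).+1.
have rS s : (S0 <= s)%N -> r <= s.+2%:R.
  move=> sS; rewrite (le_trans (ltW (truncnS_gt r))) // ler_nat.
  by rewrite (leq_trans sS) // -addn2 leq_addr.
have n0 s : 0 <= \sum_(i < s.+1) enorm r (U s i).
  by apply: sumr_ge0 => i _; exact: enorm_ge0.
exists (\sum_(s < S0) \sum_(i < s.+1) enorm r (U s i) + 2 * theta S0).
  by rewrite addr_ge0 ?sumr_ge0 // mulr_ge0 // ltW // theta_gt0.
move=> L; rewrite (@le_trans _ _ (\sum_(s < S0 + L) \sum_(i < s.+1) enorm r (U s i))) //.
  rewrite addnC big_split_ord /= lerDl.
  by apply: sumr_ge0 => s _; exact: n0.
rewrite big_split_ord /= lerD2l (le_trans _ (theta_sum S0 (S0 + L))) //.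
have -> : \sum_(S0 <= s < S0 + L) theta s = \sum_(s < L) (theta (S0 + s) : R).
  rewrite -{1}(add0n S0) big_addn addKn big_mkord.
  by apply: eq_bigr => s _; rewrite addnC.
apply: ler_sum => s _; rewrite (le_trans _ (U_small D _)) //.
by apply: ler_sum => i _; rewrite enorm_le_radius // rS // leq_addr.
Qed.

End construction_bounds.

(** * Orbits of the combinations *)

Section construction_estimates.
Context {R : realType} {K : scalars R} {P : {poly K}} {j : nat -> nat}.
Context {w : nat -> {poly K}} (D : construction P j w) (co : coordinates K).
Implicit Types (a b : nat -> K) (r A B : R).

Local Notation M := (mexp D).
Local Notation N := (npow D).
Local Notation U := (ucor D).

Definition growth a r B := forall i, absr (a i) * r ^+ M i <= B.

(** The entire functions with exponents in the range of [M], given by their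
    coefficients. *)
Definition rapid a := forall k : nat, exists B, growth a k%:R B.

Lemma growth_ge0 a r B : 0 <= r -> growth a r B -> 0 <= B.
Proof. by move=> r0 /(_ 0%N); apply: le_trans; rewrite mulr_ge0 ?absr_ge0 ?exprn_ge0. Qed.

(** Doubling the radius gains the factor [2 ^ M s], and [s <= M s]. *)
Lemma growth_half a r B s : 0 <= r -> growth a (2 * r) B ->
  absr (a s) * r ^+ M s <= B * 2^-1 ^+ s.
Proof.
move=> r0 aB; have B0 := growth_ge0 (mulr_ge0 (ler0n _ _) r0) aB.
have h : absr (a s) * r ^+ M s <= B * 2^-1 ^+ M s.
  rewrite exprVn ler_pdivlMr ?exprn_gt0 // -mulrA [X in _ * X]mulrC -exprMn.
  exact: aB.
rewrite (le_trans h) // ler_wpM2l //.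
by rewrite ler_wiXn2l ?M_ge // ?invr_ge0 // invf_le1 // ler1n.
Qed.

Lemma growth_le a r B i : 1 <= r -> growth a r B -> absr (a i) <= B.
Proof.
move=> r1 /(_ i); apply: le_trans; rewrite ler_peMr ?absr_ge0 //.
by rewrite exprn_ege1.
Qed.

Lemma enorm_block a s r A : 0 <= r -> (forall i, absr (a i) <= A) ->
  enorm r (block D a s) <=
    absr (a s) * r ^+ M s + A * \sum_(i < s.+1) enorm r (U s i).
Proof.
move=> r0 aA; rewrite /enorm (le_trans (wnormD _ _ _)) //.
  by move=> l; exact: ewt_ge0.
rewrite -!/(enorm _ _) [X in X + _]wnormZ -/(enorm r _) enorm_mono lerD2l.
rewrite (le_trans (wnorm_sum _ _ _ _)) //; first by move=> l; exact: ewt_ge0.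
rewrite mulr_sumr; apply: ler_sum => i _; rewrite wnormZ.
by rewrite ler_wpM2r // enorm_ge0.
Qed.

(** The monomials are summable because of [growth_half], the perturbations
    because of [U_bound]. *)
Lemma nbnd_coefs a r B E : 1 <= r -> growth a (2 * r) B ->
  (forall L, \sum_(s < L) \sum_(i < s.+1) enorm r (U s i) <= E) ->
  nbnd (coefs D a) r (B * (2 + E)).
Proof.
move=> r1 aB UE; have r0 : 0 <= r by rewrite (le_trans _ r1).
have r2 : 1 <= 2 * r by lra.
have B0 : 0 <= B by apply: growth_ge0 aB; rewrite mulr_ge0.
have := @nbnd_of_partial _ _ _ _ _ D 1 a 0 r (B * (2 + E)) 0 r0.
have -> : (fun l => Ts 1 (coefs D a) l - (0 : {poly K})`_l) = coefs D a.
  by apply/funext => l; rewrite Ts1 coef0 subr0.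
apply=> L _; rewrite Tp1 subr0 /enorm (le_trans (wnorm_sum _ _ _ _)) //.
  by move=> l; exact: ewt_ge0.
apply: le_trans (ler_sum _ (fun (s : 'I_L) _ =>
  enorm_block s r0 (fun i => growth_le i r2 aB))) _.
rewrite big_split /= [leRHS]mulrDr lerD //; last first.
  by rewrite -mulr_sumr ler_wpM2l // UE.
rewrite (@le_trans _ _ (\sum_(0 <= s < L) B * 2^-1 ^+ s)) //.
  by rewrite big_mkord ler_sum // => s _; exact: growth_half.
by rewrite (le_trans (expr_half_sum 0 L B0)) // expr0 mulr1 mulrC.
Qed.

Lemma nbnd_le_radius (c : nat -> K) r s B : 0 <= r -> r <= s ->
  nbnd c s B -> nbnd c r B.
Proof.
move=> r0 rs cB L; rewrite (le_trans _ (cB L)) // ler_sum // => l _.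
by rewrite ler_wpM2l ?absr_ge0 // ewt_mono.
Qed.

Lemma entire_coefs a : rapid a -> entire (coefs D a).
Proof.
move=> sa r r0; pose k := (Num.truncn r).+1.
have rk : r <= k%:R by rewrite ltW // truncnS_gt.
have [B aB] := sa (2 * k)%N; rewrite natrM in aB.
have [E E0 UE] := U_bound D (ler0n R k).
exists (B * (2 + E)); apply: nbnd_le_radius r0 rk _.
by apply: nbnd_coefs => //; rewrite ler1n.
Qed.

Lemma rapid_lin c a b : rapid a -> rapid b ->
  rapid (fun i => c * a i + b i).
Proof.
move=> sa sb k; have [A aA] := sa k; have [B bB] := sb k.
exists (absr c * A + B) => i.
rewrite (le_trans _ (lerD (ler_wpM2l (absr_ge0 c) (aA i)) (bB i))) //.
rewrite mulrA -mulrDl ler_wpM2r ?exprn_ge0 // -absrM; exact: absrD.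
Qed.

(** The sum of the series of all the [a i] times the [i]-th vector. *)
Definition vec a : Cinf K := smooth_of co (coefs D a).

Lemma vec_lin c a b : rapid a -> rapid b ->
  vec (fun i => c * a i + b i) = c *: vec a + vec b.
Proof.
move=> sa sb; rewrite /vec -smooth_of_lin; try exact: entire_coefs.
by congr smooth_of; apply/funext => l; rewrite coefs_lin.
Qed.

Lemma pk_vec_le k : exists2 C, 0 <= C & forall a B, rapid a ->
  growth a (2 * (k%:R + 1)) B -> pk k (vec a) <= C * B.
Proof.
have k0 : 0 <= k%:R + 1 :> R by rewrite addr_ge0.
have [E E0 UE] := U_bound D k0.
pose C := (\sum_(l < k) l`!%:R : R) * (2 + E).
exists C => [|a B sa aB]; first by rewrite mulr_ge0 ?sumr_ge0 ?addr_ge0.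
rewrite /C -mulrA [X in _ * X]mulrC; apply: pk_smooth_of.
  exact: entire_coefs.
by apply: nbnd_coefs => //; rewrite lerDr.
Qed.

(** Grouping by vectors instead of stages, as needed to apply [target]. *)
Lemma partial_exchange a t : partial D a t.+1 =
  \sum_(i < t.+1) a i *: (mono (M i) + \sum_(s < t.+1) U s i).
Proof.
have -> : \sum_(i < t.+1) a i *: (mono (M i) + \sum_(s < t.+1) U s i) =
   \sum_(i < t.+1) a i *: mono (M i) +
   \sum_(s < t.+1) \sum_(i < t.+1) a i *: U s i.
  rewrite exchange_big -big_split; apply: eq_bigr => i _ /=.
  by rewrite scalerDr scaler_sumr.
rewrite -big_split; apply: eq_bigr => s _ /=; congr (_ + _).
rewrite (big_ord_widen t.+1 (fun i => a i *: U s i)) ?ltn_ord //.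
rewrite [RHS](bigID (fun i : 'I_t.+1 => (i < s.+1)%N)) /= [X in _ = _ + X]big1 ?addr0 //.
by move=> i; rewrite -leqNgt => si; rewrite U_triangular ?scaler0.
Qed.

(** The stages up to [t] contribute the target with an error [theta t].  A later
    monomial costs at most a factor [2 ^ M s], absorbed by the radius, and the
    later perturbations were chosen small after the power [N t] was known. *)
Lemma power_estimate t a r B : 0 <= r -> r <= t%:R -> (j t <= t)%N ->
  growth a (4 * (r + 1)) B -> forall L, (t < L)%N ->
  enorm r (Tp (P ^+ N t) (partial D a L) - a (j t) *: w t) <=
    2 * B * 2^-1 ^+ t.
Proof.
move=> r0 rt jt aB L tL; have wr l : 0 <= ewt r l by exact: ewt_ge0.
have r1 : 0 <= r + 1 by rewrite addr_ge0.
have r4 : 1 <= 4 * (r + 1) by lra.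
have aA i : absr (a i) <= B := growth_le i r4 aB.
have B0 : 0 <= B by rewrite (le_trans (absr_ge0 (a 0%N))).
have h1 : enorm r (Tp (P ^+ N t) (partial D a t.+1) - a (j t) *: w t) <= B * theta t.
  have -> : a (j t) *: w t = \sum_(i < t.+1) a i *: ((i == j t :> nat)%:R *: w t).
    have jt' : (j t < t.+1)%N by [].
    rewrite (bigD1 (Ordinal jt')) //= eqxx scale1r big1 ?addr0 // => i.
    by rewrite -val_eqE /= => /negbTE ->; rewrite scale0r scaler0.
  rewrite partial_exchange linear_sum -sumrB /enorm.
  rewrite (le_trans (wnorm_sum wr _ _ _)) //.
  apply: le_trans (ler_wpM2l B0 (target D t)).
  rewrite mulr_sumr; apply: ler_sum => i _.
  rewrite linearZ /= -scalerBr wnormZ -/(enorm _ _).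
  rewrite ler_pM ?absr_ge0 ?enorm_ge0 // enorm_le_radius //.
have h2 s : (t < s)%N -> enorm r (Tp (P ^+ N t) (block D a s)) <=
    B * 2^-1 ^+ s + B * theta s.
  move=> ts; rewrite linearD /= linearZ /= linear_sum /=.
  rewrite /enorm (le_trans (wnormD wr _ _)) // lerD //.
    rewrite wnormZ -/(enorm r _).
    rewrite (le_trans (ler_wpM2l (absr_ge0 _) (enorm_Tp _ _ r0))) //.
    rewrite enorm_mono.
    have gh : absr (a s) * (2 * (r + 1)) ^+ M s <= B * 2^-1 ^+ s.
      apply: growth_half; first by rewrite mulr_ge0.
      by move: aB; rewrite (_ : 4 * (r + 1) = 2 * (2 * (r + 1)) :> R) //; ring.
    apply: le_trans gh; rewrite ler_wpM2l ?absr_ge0 // exprMn.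
    by rewrite ler_wpM2r ?exprn_ge0 // Tcost_le.
  rewrite (le_trans (wnorm_sum wr _ _ _)) //.
  apply: le_trans (ler_wpM2l B0 (TU_small D ts)).
  rewrite mulr_sumr; apply: ler_sum => i _.
  rewrite linearZ /= wnormZ -/(enorm r _) ler_pM ?absr_ge0 ?enorm_ge0 //.
  rewrite (le_trans (enorm_Tp _ _ r0)) // ler_wpM2l ?Tcost_ge0 //.
  rewrite enorm_le_radius // -[s.+2%:R]natr1 lerD2r (le_trans rt) // ler_nat.
  by rewrite ltnW // ltnS ltnW.
have -> : partial D a L = partial D a t.+1 + \sum_(t.+1 <= s < L) block D a s.
  by rewrite /partial -!(big_mkord xpredT) -big_cat_nat.
rewrite linearD /= addrAC /enorm (le_trans (wnormD wr _ _)) //.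
rewrite -/(enorm r _).
have h3 : enorm r (Tp (P ^+ N t) (\sum_(t.+1 <= s < L) block D a s)) <=
    B * 2^-1 ^+ t + B * theta t.
  rewrite linear_sum /enorm (le_trans (wnorm_sum wr _ _ _)) //.
  rewrite (@le_trans _ _ (\sum_(t.+1 <= s < L) (B * 2^-1 ^+ s + B * theta s))) //.
    by apply: ler_sum_nat => s /andP[ts _]; exact: h2.
  rewrite big_split /= lerD //.
    rewrite (le_trans (expr_half_sum _ _ B0)) // exprS.
    by rewrite le_eqVlt; apply/orP; left; apply/eqP; field.
  rewrite -mulr_sumr ler_wpM2l // (le_trans (theta_sum _ _)) // /theta exprS.
  by rewrite le_eqVlt; apply/orP; left; apply/eqP; field.
apply: le_trans (lerD h1 h3) _.
have e0 : 0 <= B * 2^-1 ^+ t by rewrite mulr_ge0 ?exprn_ge0.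
rewrite /theta; lra.
Qed.

(** The bound of [power_estimate] does not depend on the number of stages, so it
    holds for the infinite combination. *)
Lemma power_vec k a : rapid a -> exists2 C, 0 <= C &
  forall t, (k.+1 <= t)%N -> (j t <= t)%N ->
    pk k (iter (N t) (polyD P) (vec a) - a (j t) *: smooth_of co (pc (w t)))
      <= C * 2^-1 ^+ t.
Proof.
move=> sa; have [B] := sa (4 * k.+2)%N; rewrite natrM -[k.+2%:R]natr1 => aB.
have B0 : 0 <= B by apply: growth_ge0 aB; rewrite mulr_ge0 ?addr_ge0.
pose C := (\sum_(l < k) l`!%:R : R) * (2 * B).
exists C => [|t kt jt]; first by rewrite !mulr_ge0 ?sumr_ge0.
have ea := entire_coefs sa.
have [eT ->] := iter_polyD_smooth_of co P (N t) ea.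
have -> : smooth_of co (Ts (P ^+ N t) (coefs D a)) - a (j t) *: smooth_of co (pc (w t)) =
    smooth_of co (fun l => Ts (P ^+ N t) (coefs D a) l - (a (j t) *: w t)`_l).
  rewrite addrC -scaleNr -smooth_of_lin //; last exact: entire_pc.
  by congr smooth_of; apply/funext => l; rewrite coefZ mulNr addrC.
rewrite /C -mulrA; apply: pk_smooth_of.
  rewrite (_ : (fun l => _) = (fun l => - a (j t) * (w t)`_l + Ts (P ^+ N t) (coefs D a) l)).
    by apply: entire_lin => //; exact: entire_pc.
  by apply/funext => l; rewrite coefZ mulNr addrC.
apply: (@nbnd_of_partial _ _ _ _ _ D _ a _ _ _ t.+1); first by rewrite addr_ge0.
move=> L tL; apply: power_estimate => //.
  by rewrite natr1 ler_nat.
by rewrite natr1.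
Qed.

End construction_estimates.

(** * The space of combinations is closed *)

Section hypercyclic_span.
Context {R : realType} {K : scalars R} {P : {poly K}} {j : nat -> nat}.
Context {w : nat -> {poly K}} (D : construction P j w) (co : coordinates K).
Implicit Types (a b : nat -> K) (f : Cinf K) (r A B E e : R).

Local Notation M := (mexp D).
Local Notation N := (npow D).
Local Notation U := (ucor D).
Local Notation vec := (vec D co).
Local Notation rapid := (rapid D).
Local Notation growth := (growth D).

Lemma half_pow_eventually B e : 0 < e ->
  exists L0, forall L, (L0 <= L)%N -> B * 2^-1 ^+ L <= e.
Proof.
move=> e0; have [L0 L0P] := exists_pow2_ge (B / e).
exists L0 => L /L0P; rewrite ler_pdivrMr // => BL.
by rewrite exprVn ler_pdivrMr ?exprn_gt0 // mulrC.
Qed.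

Lemma pk_eval k f x : (0 < k)%N -> `|x| <= k%:R ->
  `|f x : realified K| <= pk k f.
Proof.
case: k => // k _ xk; rewrite /pk big_ord_recl ler_wpDr //.
  by apply: sumr_ge0 => l _; exact: sup_derivn_ge0.
by apply: (@sup_derivn_ub _ _ 0 f k.+1 x); rewrite in_itv /= -ler_norml.
Qed.

Lemma pser_mono m y : pser co (pc (mono m)) y = (y ^+ m) *: ((1 : K) : realified K).
Proof.
rewrite (@pser_pc _ _ co (mono m) y m.+1); last first.
  by rewrite (leq_trans (size_scale_leq _ _)) // size_polyXn.
rewrite big_ord_recr /= big1 ?add0r => [|l _].
  rewrite coef_mono eqxx mulr1n !realified_scaleE mulr1 -(rmorph_nat (of_real K)) -rmorphM.
  by congr (of_real K _); rewrite divfK // pnatr_eq0 -lt0n fact_gt0.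
by rewrite coef_mono ltn_eqF //; exact: scaler0.
Qed.

Lemma pser_monos a L y :
  pser co (pc (\sum_(s < L) a s *: mono (M s))) y =
  \sum_(s < L) y ^+ M s *: (a s : realified K).
Proof.
elim: L => [|L IHL].
  rewrite !big_ord0 (@pser_pc _ _ co 0 y 0) ?size_poly0 //.
  by rewrite big_ord0.
rewrite !big_ord_recr /= -IHL.
have -> : pc (\sum_(i < L) a i *: mono (M i) + a L *: mono (M L)) =
    (fun l => a L * pc (mono (M L)) l + pc (\sum_(i < L) a i *: mono (M i)) l).
  by apply/funext => l; rewrite /pc coefD coefZ addrC.
rewrite pser_lin; try exact: entire_pc; last first.
  by apply: entire_lin; exact: entire_pc.
rewrite pser_mono addrC; congr (_ + _).
by rewrite !realified_scaleE mulr1 mulrC.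
Qed.

(** Removing the perturbations and a tail of the series leaves a lacunary
    polynomial, whose coefficients are bounded on the interval [0, k]. *)
Lemma coef_lower_bound k a A E : (0 < k)%N -> rapid a ->
  (forall i, absr (a i) <= A) ->
  (forall L, \sum_(s < L) \sum_(i < s.+1) enorm (k%:R + 1) (U s i) <= E) ->
  forall i, absr (a i) * k%:R ^+ M i <=
    4 * (pk k (vec a) + (\sum_(l < k) l`!%:R) * (A * E)).
Proof.
move=> k0 sa aA UE i; apply/ler_addgt0Pr => e e0.
have k1 : 0 <= k%:R + 1 :> R by rewrite addr_ge0.
pose C := \sum_(l < k) l`!%:R : R; have C0 : 0 <= C by apply: sumr_ge0.
have [B] := sa (2 * k.+1)%N; rewrite natrM -[k.+1%:R]natr1 => aB.
have B0 : 0 <= B by apply: growth_ge0 aB; rewrite mulr_ge0.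
have A0 : 0 <= A by rewrite (le_trans (absr_ge0 (a 0%N))).
have [L0 L0P] := half_pow_eventually (4 * (C * (2 * B))) e0.
pose L := maxn L0 i.+1.
have LP : 4 * (C * (2 * B * 2^-1 ^+ L)) <= e.
  by rewrite [C * _]mulrA mulrA L0P // leq_maxl.
pose G := \sum_(s < L) a s *: mono (M s).
have wr l : 0 <= ewt (k%:R + 1 : R) l by exact: ewt_ge0.
have nG : nbnd (fun l => Ts 1 (coefs D a) l - G`_l) (k%:R + 1) (A * E + 2 * B * 2^-1 ^+ L).
  apply: (@nbnd_of_partial _ _ _ _ _ D 1 a G _ _ L) => // L' LL'; rewrite Tp1.
  have -> : partial D a L' - G = \sum_(s < L') \sum_(i < s.+1) a i *: U s i +
      \sum_(L <= s < L') a s *: mono (M s).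
    rewrite /partial big_split /= addrAC addrC; congr (_ + _).
    rewrite /G -!(big_mkord xpredT (fun s => a s *: mono (M s))).
    by rewrite (big_cat_nat _ LL') //= addrAC subrr add0r.
  rewrite /enorm (le_trans (wnormD wr _ _)) // lerD //.
    rewrite (le_trans (wnorm_sum wr _ _ _)) //.
    apply: le_trans (ler_wpM2l A0 (UE L')); rewrite mulr_sumr.
    apply: ler_sum => s _; rewrite (le_trans (wnorm_sum wr _ _ _)) // mulr_sumr.
    apply: ler_sum => i0 _; rewrite wnormZ ler_wpM2r //; exact: enorm_ge0.
  rewrite (le_trans (wnorm_sum wr _ _ _)) //.
  rewrite (le_trans _ (expr_half_sum L L' B0)) //.
  apply: ler_sum => s _; rewrite wnormZ -/(enorm _ _) enorm_mono.
  exact: growth_half.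
have ea := entire_coefs sa.
have pG : pk k (smooth_of co (pc G)) <=
    pk k (vec a) + C * (A * E + 2 * B * 2^-1 ^+ L).
  have -> : smooth_of co (pc G) = vec a - (vec a - smooth_of co (pc G)).
    by rewrite opprB addrC subrK.
  rewrite (le_trans (pkD _ _ _)) // pkN lerD2l.
  have -> : vec a - smooth_of co (pc G) =
      smooth_of co (fun l => Ts 1 (coefs D a) l - G`_l).
    rewrite addrC -scaleN1r -smooth_of_lin //; last exact: entire_pc.
    by congr smooth_of; apply/funext => l; rewrite Ts1 mulN1r addrC.
  apply: pk_smooth_of nG.
  rewrite (_ : (fun l => _) = (fun l => - 1 * pc G l + coefs D a l)).
    by apply: entire_lin => //; exact: entire_pc.
  by apply/funext => l; rewrite Ts1 mulN1r addrC.
have := @lacunary_coef_bound _ (realified K) M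
  (fun s => (k%:R : R) ^+ M s *: (a s : realified K)) L (pk k (smooth_of co (pc G)))
  (M_gt0 D) (M_lacunary D) _ i (leq_maxr _ _).
rewrite normrZ normrX normr_nat mulrC => H.
apply: le_trans (H _) _ => [x /andP[x0 x1]|]; last first.
  rewrite (le_trans (ler_wpM2l _ pG)) //; rewrite -/C.
  by have := LP; lra.
rewrite (_ : \sum_(i < L) _ = pser co (pc G) (k%:R * x)).
  have := @pk_eval k (smooth_of co (pc G)) (k%:R * x) k0.
  rewrite smooth_ofE; last exact: entire_pc.
  by apply; rewrite normrM normr_nat ger0_norm // ler_piMr.
rewrite pser_monos; apply: eq_bigr => s _.
by rewrite scalerA exprMn mulrC.
Qed.

(** For [k = 1] the perturbations cost at most half the supremum of the
    coefficients, which is finite and can be absorbed on the left. *)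
Lemma coef_bound1 a i : rapid a -> absr (a i) <= 8 * pk 1 (vec a).
Proof.
move=> sa; have [B] := sa 1%N => aB.
have aB' n : absr (a n) <= B by apply: growth_le aB.
have UE L : \sum_(s < L) \sum_(i < s.+1) enorm (1%:R + 1 : R) (U s i) <= 8^-1.
  apply: (@le_trans _ _ (\sum_(0 <= s < L) theta s)).
    rewrite big_mkord; apply: ler_sum => s _; rewrite (le_trans _ (U_small D s)) //.
    apply: ler_sum => n _; rewrite enorm_le_radius // ?addr_ge0 //.
    by rewrite natr1 ler_nat.
  rewrite (le_trans (theta_sum _ _)) // /theta expr0.
  by rewrite le_eqVlt; apply/orP; left; apply/eqP; field.
(* The bound at each n is 4 * (pk 1 (vec a) + S / 8), for S the supremum. *)
pose S := sup [set absr (a n) | n in [set: nat]].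
have hS : has_sup [set absr (a n) | n in [set: nat]].
  by split; [exists (absr (a 0%N)), 0%N|exists B => _ [n _ <-]].
have aS n : absr (a n) <= S by apply: sup_ubound; [exact: hS.2|exists n].
have : S <= 4 * (pk 1 (vec a) + S / 8).
  apply: ge_sup; first exact: hS.1.
  move=> _ [n _ <-]; have := coef_lower_bound (ltnSn 0) sa aS UE n.
  by rewrite expr1n mulr1 big_ord1 mul1r.
have := aS i; lra.
Qed.

(** The bound for [k = 1] controls the perturbations in all other seminorms. *)
Lemma coef_bound k : (0 < k)%N -> exists2 C, 0 <= C & forall a i, rapid a ->
  absr (a i) * k%:R ^+ M i <= C * pk k (vec a).
Proof.
move=> k0; have k1 : 0 <= k%:R + 1 :> R by rewrite addr_ge0.
have [E E0 UE] := U_bound D k1.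
pose C := \sum_(l < k) l`!%:R : R; have C0 : 0 <= C by apply: sumr_ge0.
exists (4 * (1 + C * (8 * E))) => [|a i sa].
  by rewrite mulr_ge0 // addr_ge0 // mulr_ge0 // mulr_ge0.
have aA n : absr (a n) <= 8 * pk k (vec a).
  by rewrite (le_trans (coef_bound1 n sa)) // ler_wpM2l // pk_mono.
rewrite (le_trans (coef_lower_bound k0 sa aA UE i)) // -/C.
by rewrite le_eqVlt; apply/orP; left; apply/eqP; ring.
Qed.

Lemma pser_at0 c : entire c -> pser co c 0 = c 0%N.
Proof.
move=> ec; apply: realified_cvg_unique (@pser_cvg _ _ co _ 0 ec) _.
apply: cvg_near_cst; exists 1%N => // -[//|L] _.
rewrite big_ord_recl /= expr0 fact0 divr1 scale1r big1 ?addr0 // => l _.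
by rewrite expr0n mul0r scale0r.
Qed.

(** The [i]-th coefficient as a continuous functional on the whole space.  It
    passes to limits without any appeal to the completeness of the scalars. *)
Definition phi i f : K := (M i)`!%:R^-1 * (Defs.derivn (M i) f 0 : K).

Lemma phi_vec a i : rapid a -> phi i (vec a) = a i.
Proof.
move=> sa; have ea := entire_coefs sa.
rewrite /phi /vec derivn_smooth_of // pser_at0; last exact: entire_shift.
by rewrite addn0 coefs_M mulKf.
Qed.

Lemma phi_lin c f g i : phi i (c *: f + g) = c * phi i f + phi i g.
Proof. by rewrite /phi Defs.derivn_lin mulrDr mulrCA. Qed.

Lemma phi_sub f g i : phi i (f - g) = phi i f - phi i g.
Proof. by rewrite addrC -scaleN1r phi_lin mulN1r addrC. Qed.

Lemma phi_le i f k : (M i < k)%N -> absr (phi i f) <= pk k f.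
Proof.
move=> ik; rewrite /phi absrM absrV absr_nat mulrC ler_pdivrMr ?fact_gt0R //.
rewrite (@le_trans _ _ (pk k f)) //; last first.
  by rewrite ler_peMr ?pk_ge0 // ler1n fact_gt0.
rewrite /pk (bigD1 (Ordinal ik)) //= ler_wpDr //.
  by apply: sumr_ge0 => l _; exact: sup_derivn_ge0.
by apply: (@sup_derivn_ub _ _ (M i) f k 0); rewrite in_itv /= oppr_le0 !ler0n.
Qed.

Definition hspan : set (Cinf K) := [set f | exists2 a, rapid a & f = vec a].

(** Adherence to [hspan], in terms of the seminorms. *)
Definition adherent f := forall k e, 0 < e ->
  exists2 a, rapid a & pk k (vec a - f) < e.

(** Both sides of [coef_bound] are continuous in the function. *)
Lemma phi_bound k : (0 < k)%N -> exists2 C, 0 <= C & forall f i, adherent f ->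
  absr (phi i f) * k%:R ^+ M i <= C * pk k f.
Proof.
move=> k0; have [C C0 CP] := coef_bound k0; exists C => // f i af.
apply/ler_addgt0Pr => e e0.
pose c := C + k%:R ^+ M i; have c0 : 0 < c + 1.
  by rewrite ltr_wpDl // addr_ge0 // exprn_ge0.
have [a sa afe] := af (maxn k (M i).+1) _ (divr_gt0 e0 c0).
set d := e / _ in afe; have d0 : 0 < d by rewrite divr_gt0.
have h1 : pk k (vec a) <= d + pk k f.
  rewrite -(subrK f (vec a)) (le_trans (pkD _ _ _)) // lerD2r ltW //.
  by rewrite (le_lt_trans _ afe) // pk_mono // leq_maxl.
have h2 : absr (phi i f) <= d + absr (a i).
  have -> : phi i f = - phi i (vec a - f) + a i.
    by rewrite phi_sub phi_vec // opprB subrK.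
  rewrite (le_trans (absrD _ _)) // absrN lerD2r ltW // (le_lt_trans _ afe) //.
  by rewrite phi_le // leq_maxr.
have h3 := CP a i sa.
have kM : 0 <= k%:R ^+ M i :> R by rewrite exprn_ge0.
apply: le_trans (ler_wpM2r kM h2) _; rewrite mulrDl.
have h4 : absr (a i) * k%:R ^+ M i <= C * d + C * pk k f.
  by rewrite (le_trans h3) // -mulrDr ler_wpM2l.
have h5 : (C + k%:R ^+ M i) * d <= e.
  rewrite /d mulrCA ler_piMr ?(ltW e0) // ler_pdivrMr // mul1r lerDl //.
lra.
Qed.

Lemma adherent_sub f b : adherent f -> rapid b -> adherent (f - vec b).
Proof.
move=> af sb k e e0; have [a sa afe] := af k e e0.
exists (fun i => -1 * b i + a i); first exact: rapid_lin.
by rewrite vec_lin // scaleN1r opprB addrACA addNr add0r.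
Qed.

Lemma rapid_phi f : adherent f -> rapid (fun i => phi i f).
Proof.
move=> af k; have [C C0 CP] := phi_bound (ltn0Sn k).
exists (C * pk k.+1 f) => i; rewrite (le_trans _ (CP f i af)) //.
rewrite ler_wpM2l ?absr_ge0 // lerXn2r ?nnegrE // ler_nat //.
Qed.

Lemma pk_separates f g : (forall k e, 0 < e -> pk k (f - g) <= e) -> f = g.
Proof.
move=> fg; apply: cinf_eq => x; apply/eqP; rewrite -subr_eq0.
apply/eqP/absr0_eq0/le_anti; rewrite absr_ge0 andbT.
apply/ler_addgt0Pr => e e0; rewrite add0r.
pose k := (Num.truncn `|x|).+1.
apply: le_trans (fg k e e0).
by apply: (@pk_eval k (f - g) x) => //; rewrite ltW // truncnS_gt.
Qed.

(** The candidate is the combination with the coefficients [phi i f].  For [vec b]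
    close to [f], the function [f - vec b] is adherent as well, and [phi_bound]
    makes its coefficients, hence [vec (phi f) - vec b], small. *)
Lemma hspan_adherent f : adherent f -> hspan f.
Proof.
move=> af; have sphi := rapid_phi af.
exists (fun i => phi i f) => //; apply: esym; apply: pk_separates => k e e0.
have [C C0 CP] := pk_vec_le D co k.
have k2 : (0 < 2 * k.+1)%N by rewrite muln_gt0.
have [C' C'0 C'P] := phi_bound k2.
pose c := C * C' + 1; have c0 : 0 < c + 1.
  by rewrite addr_gt0 // ltr_wpDl // mulr_ge0.
have [b sb bfe] := af (maxn k (2 * k.+1)) _ (divr_gt0 e0 c0).
set d := e / _ in bfe; have d0 : 0 < d by rewrite divr_gt0.
have h1 : pk k (vec b - f) <= d.
  by rewrite ltW // (le_lt_trans _ bfe) // pk_mono // leq_maxl.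
have h2 : pk (2 * k.+1) (f - vec b) <= d.
  by rewrite -opprB pkN ltW // (le_lt_trans _ bfe) // pk_mono // leq_maxr.
pose a i := -1 * b i + phi i f.
have sa : rapid a by exact: rapid_lin.
have aE i : a i = phi i (f - vec b).
  by rewrite phi_sub phi_vec // /a mulN1r addrC.
have ga : growth a (2 * (k%:R + 1)) (C' * d).
  move=> i; rewrite aE natr1 -natrM.
  rewrite (le_trans (C'P _ i (adherent_sub af sb))) //.
  by rewrite ler_wpM2l.
have h3 := CP a _ sa ga.
have -> : vec (fun i => phi i f) - f = vec a + (vec b - f).
  by rewrite /a vec_lin // scaleN1r addrACA addNr add0r.
rewrite (le_trans (pkD _ _ _)) // (le_trans (lerD h3 h1)) //.
rewrite (_ : C * (C' * d) + d = c * d); last by rewrite /c; ring.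
by rewrite /d mulrCA ler_piMr ?(ltW e0) // ler_pdivrMr // mul1r lerDl.
Qed.

Lemma closed_hspan : closed hspan.
Proof.
move=> f cf; apply: hspan_adherent => k e e0.
have [_ [[a sa ->] /= afe]] := cf _ (nbhs_pk f k e0).
by exists a.
Qed.

Lemma subspace_hspan : Defs.subspace hspan.
Proof.
have s0 : rapid (fun=> 0).
  by move=> k; exists 0 => i; rewrite absr0 mul0r.
split=> [|c f g [a sa ->] [b sb ->]].
  exists (fun i => -1 * 0 + 0); first exact: rapid_lin.
  by rewrite vec_lin // scaleN1r addNr.
by exists (fun i => c * a i + b i); [exact: rapid_lin|rewrite vec_lin].
Qed.

Lemma rapid_delta n : rapid (fun i => (i == n)%:R).
Proof.
move=> k; exists (k%:R ^+ M n) => i; case: eqP => [->|_].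
  by rewrite absr1 mul1r.
by rewrite absr0 mul0r exprn_ge0.
Qed.

(** The functionals [phi] and the vectors of the unit sequences are biorthogonal;
    a finite generating family would factor the identity matrix of size [n + 1]
    through dimension [n]. *)
Lemma infinite_dimensional_hspan : ~ finite_dimensional hspan.
Proof.
move=> [n [e [eh sp]]].
pose A : 'M[K]_(n.+1, n) := \matrix_(i, l)
  projT1 (cid (sp _ (ex_intro2 _ _ _ (rapid_delta i) erefl))) l.
pose B : 'M[K]_(n, n.+1) := \matrix_(l, i) phi i (e l).
have phi0 i : phi i 0 = 0.
  have := phi_lin 1 0 0 i; rewrite scale1r addr0 mul1r => h.
  by apply: (@addrI _ (phi i 0)); rewrite addr0.
have phi_sum i (c : 'I_n -> K) : phi i (\sum_(l < n) c l *: e l) =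
    \sum_(l < n) c l * phi i (e l).
  rewrite (big_morph (phi i) (id1 := 0) (op1 := +%R) _ (phi0 i)).
    apply: eq_bigr => l _.
    by have := phi_lin (c l) (e l) 0 i; rewrite !addr0 phi0 addr0.
  by move=> x y; have := phi_lin 1 x y i; rewrite scale1r mul1r.
have AB : A *m B = 1%:M.
  apply/matrixP => i i'; rewrite !mxE -val_eqE /= eq_sym.
  rewrite -(phi_vec i' (rapid_delta i)).
  rewrite (projT2 (cid (sp _ (ex_intro2 _ _ _ (rapid_delta i) erefl)))) phi_sum.
  by apply: eq_bigr => l _; rewrite !mxE.
have := mulmx_max_rank A B; rewrite AB mxrank1; lia.
Qed.

End hypercyclic_span.

(** * Hypercyclic subspaces *)

Section existence.
Context {R : realType} {K : scalars R} (co : coordinates K).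

Lemma injective_unbounded (f : nat -> nat) n : injective f ->
  exists N, (n <= f N)%N.
Proof.
move=> fi; apply: contrapT => H.
have fn N : (f N < n)%N by rewrite ltnNge; apply/negP => h; apply: H; exists N.
pose g (i : 'I_n.+1) : 'I_n := Ordinal (fn i).
have gi : injective g by move=> i i' /(congr1 val) /= /fi /val_inj.
by have := leq_card g gi; rewrite !card_ord ltnn.
Qed.

(** Each pair occurs infinitely often, as the third component of the decoded
    triple is dropped. *)
Definition request (s : nat) : nat * seq (rat * rat) :=
  if unpickle s is Some x then (x : nat * seq (rat * rat) * nat).1 else (0%N, [::]).

Lemma request_frequent x n : exists2 t, (n <= t)%N & request t = x.
Proof.
have fi : injective (fun N : nat => pickle (x, N)).
  by move=> N N' /(pcan_inj (@pickleK _)) [].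
by have [N nN] := injective_unbounded n fi; exists (pickle (x, N)); rewrite // /request pickleK.
Qed.

(** Divide the function to be approximated by a nonzero coefficient [a i], and
    wait for a stage that asks for the index [i] and for a polynomial close to
    the quotient. *)
Lemma hypercyclic_vec (P : {poly K})
    (D : construction P (fun s => (request s).1) (fun s => ratpoly co (request s).2))
    (x : Cinf K) : hspan D co x -> x != 0 -> hypercyclic (polyD P) x.
Proof.
move=> [a ra ->] x0.
have [i ai] : exists i, a i != 0.
  apply: contrapT => H; move/eqP: x0; apply.
  (* The zero sequence, in a form to which linearity applies. *)
  rewrite (_ : a = fun i => -1 * a i + a i); last first.
    by apply/funext => i; rewrite mulN1r addNr; apply: contrapT => /eqP h; apply: H; exists i.
  by rewrite vec_lin // scaleN1r addNr.
move=> O [f Of] oO.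
have [k [e [e0 kO]]] : nbhs f O by exact: open_nbhs_nbhs.
have c0 : 0 < absr (a i) by exact: absr_gt0.
have e2 : 0 < e / 2 by rewrite divr_gt0.
have [q qP] := ratpoly_smooth_of_dense co ((a i)^-1 *: f) k (divr_gt0 e2 c0).
have [C C0 CP] := power_vec co k ra.
have e4 : 0 < e / 4 by rewrite divr_gt0.
have [L0 L0P] := half_pow_eventually C e4.
have [t tP tE] := request_frequent (i, q) (maxn (maxn k.+1 i) L0).
move: tP; rewrite !geq_max -andbA => /and3P[kt it L0t].
have jt : ((request t).1 <= t)%N by rewrite tE.
have := CP t kt jt; rewrite tE /= => h1.
exists (iter (npow D t) (polyD P) (vec D co a)); split; last by exists (npow D t).
apply: kO => /=; set y := iter _ _ _; set z := smooth_of _ _ in h1 qP.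
have h2 : pk k (a i *: z - f) <= e / 2.
  have -> : a i *: z - f = a i *: (z - (a i)^-1 *: f).
    by rewrite scalerBr scalerA divff // scale1r.
  by rewrite pkZ mulrC -ler_pdivlMr.
have h3 := L0P t L0t.
rewrite -(subrKA (a i *: z)) (le_lt_trans (pkD _ _ _)) //.
apply: le_lt_trans (lerD (le_trans h1 h3) h2) _; lra.
Qed.

Lemma pk_continuous k : continuous (pk k : Cinf K -> R).
Proof.
move=> f; apply/(@cvgrPdist_lt _ _ _ (nbhs f)) => e e0.
exists k, e; split=> // g /= ge.
have h1 : pk k g <= pk k (g - f) + pk k f.
  by rewrite -{1}(subrK f g) pkD.
have h2 : pk k f <= pk k (g - f) + pk k g.
  by rewrite -{1}(subrK g f) (le_trans (pkD _ _ _)) // -pkN opprB.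
by rewrite ltr_norml; apply/andP; split; lra.
Qed.

Lemma has_hypercyclic_subspace_polyD (P : {poly K}) : (1 < size P)%N ->
  has_hypercyclic_subspace_of_type1 (polyD P).
Proof.
move=> sP; have [D] := construction_exists (fun s => (request s).1)
  (fun s => ratpoly co (request s).2) sP.
exists (hspan D co); split.
  split; [exact: subspace_hspan|exact: closed_hspan|
    exact: infinite_dimensional_hspan|exact: hypercyclic_vec].
exists (pk 1); split; [exact: pk_seminorm|exact: pk_continuous|].
apply/seteqP; split=> [f [[a ra ->] /= p0]|_ ->]; last first.
  split; last exact: pk0.
  exact: (subspace_hspan D co).1.
rewrite (_ : a = fun i => -1 * a i + a i); first by rewrite vec_lin // scaleN1r addNr.
apply/funext => i; rewrite mulN1r addNr; apply/absr0_eq0/le_anti.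
by rewrite absr_ge0 andbT (le_trans (coef_bound1 co i ra)) // p0 mulr0.
Qed.

End existence.

Section fields.
Variable R : realType.

Definition real_coordinates : coordinates (real_scalars R).
Proof.
apply: (@Coordinates R (real_scalars R) idfun (fun=> 0) 0) => //=.
- by move=> z; rewrite mulr0 addr0.
- by move=> s z y; rewrite mulr0 addr0.
- by move=> z; rewrite normr0.
Defined.

Definition complex_coordinates : coordinates (complex_scalars R).
Proof.
apply: (@Coordinates R (complex_scalars R) (@complex.Re R) (@complex.Im R) 'i%C) => /=.
- by move=> z; rewrite [LHS]complexE mulrC.
- by move=> s [a b] [c d] /=; rewrite mul0r subr0.
- by move=> s [a b] [c d] /=; rewrite mul0r addr0.
- by move=> [a b]; rewrite /absr /= -sqrtr_sqr ler_wsqrtr // lerDl sqr_ge0.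
- by move=> [a b]; rewrite /absr /= -sqrtr_sqr ler_wsqrtr // lerDr sqr_ge0.
Defined.

End fields.

Theorem corollary2p3 (R : realType) :
  (forall P : {poly R}, (1 < size P)%N ->
     has_hypercyclic_subspace_of_type1 (@polyD R (real_scalars R) P)) /\
  (forall P : {poly R[i]}, (1 < size P)%N ->
     has_hypercyclic_subspace_of_type1 (@polyD R (complex_scalars R) P)).
Proof.
split=> P sP.
  exact: (has_hypercyclic_subspace_polyD (real_coordinates R)).
exact: (has_hypercyclic_subspace_polyD (complex_coordinates R)).
Qed.
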